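(* Let $x$ be a nondegenerate space curve in $\mathbf{A}^3$ without affine inflection points, with first and second general-affine curvatures $k$ and $M$ and sign $\epsilon=\pm1$; let $'$ denote the derivative with respect to the general-affine length parameter. Then $x$ is general-affine extremal if and only if the following pair of ordinary differential equations is satisfied: \[ k'''+\tfrac32kk''+\tfrac12(k')^2+\tfrac12k^2k'-\tfrac15\epsilon k'+\tfrac65M'=0, \] \[ k''+\tfrac23k'k+\tfrac56\epsilon k'M-\tfrac32\epsilon kM'-\epsilon M''=0 . \] In particular, all such space curves with constant general-affine curvatures are general-affine extremal.
   Context: All curves are smooth. A parametrized curve $x=x(t)$ in $\mathbf{A}^3$ is nondegenerate if $x',x'',x'''$ are linearly independent at every point. For a nondegenerate curve there exist a frame $e_1,e_2,e_3$ along $x$ (smooth, pointwise linearly independent vector fields along $x$, with $e_1$ a positive multiple of $dx/dt$), a $1$-form $\omega$ and functions $\ell,m$ such that $dx=\omega e_1$, $de_1=\omega e_2$, $de_2=\omega e_3$, $de_3=-m\omega e_1-\ell\omega e_2$. These are unique up to $\tilde e_i=\lambda^ie_i$ ($i=1,2,3$), $\tilde\omega=\lambda^{-1}\omega$, $\tilde\ell=\lambda^2\ell$, $\tilde m=\lambda^3m$ with a constant $\lambda>0$. A point where $\ell=0$ is an affine inflection point. Where $\ell\neq0$, the sign is $\epsilon=\mathrm{sign}(\ell)$. The general-affine length element is $\omega_s=\sqrt{\epsilon\ell}\,\omega$; a general-affine length parameter is a parameter $s$ with $ds=\omega_s$. The first general-affine curvature $k$ is defined by $d\ell/\ell=k\,\omega_s$,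 and the second general-affine curvature is $M=m/(\epsilon\ell)^{3/2}$. Variations: a compactly supported deformation of $x$ is a smooth family of nondegenerate curves $x_\eta$, $\eta$ near $0$, with $x_0=x$, with $x_\eta(t)=x(t)$ for $t$ outside a compact set $C$ of parameters, and such that $\omega_s(\eta)$ (the length element of $x_\eta$) vanishes nowhere, i.e. no $x_\eta$ has an affine inflection point. The curve $x$ is general-affine extremal if, for every compactly supported deformation, the length $L(\eta)=\int_C\omega_s(\eta)$ satisfies $\frac{dL}{d\eta}\big|_{\eta=0}=0$. *)

(* Defs.v *)
From Stdlib Require Import Reals.
From Coquelicot Require Import Coquelicot.
Open Scope R_scope.

Definition V3 : NormedModule R_AbsRing :=
  prod_NormedModule R_AbsRing
    (prod_NormedModule R_AbsRing R_NormedModule R_NormedModule) R_NormedModule.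

Definition coord1 (v : V3) : R := fst (fst v).
Definition coord2 (v : V3) : R := snd (fst v).
Definition coord3 (v : V3) : R := snd v.

Definition lin_indep (u v w : V3) : Prop :=
  forall a b c : R,
    plus (plus (scal a u) (scal b v)) (scal c w) = (zero : V3) ->
    a = 0 /\ b = 0 /\ c = 0.

(* The curves below are total functions [R -> V3] of which only the values on
   an open interval, possibly unbounded, are considered. *)
Definition interval (a b : Rbar) (t : R) : Prop := Rbar_lt a t /\ Rbar_lt t b.

Definition smooth_on (I : R -> Prop) (f : R -> R) : Prop :=
  forall (n : nat) (t : R), I t -> ex_derive_n f n t.

Definition vsmooth_on (I : R -> Prop) (x : R -> V3) : Prop :=
  smooth_on I (fun t => coord1 (x t)) /\
  smooth_on I (fun t => coord2 (x t)) /\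
  smooth_on I (fun t => coord3 (x t)).

Definition vDerive_n (x : R -> V3) (n : nat) (t : R) : V3 :=
  ((Derive_n (fun u => coord1 (x u)) n t,
    Derive_n (fun u => coord2 (x u)) n t),
    Derive_n (fun u => coord3 (x u)) n t).

Definition nondegenerate (I : R -> Prop) (x : R -> V3) : Prop :=
  forall t : R, I t -> lin_indep (vDerive_n x 1 t) (vDerive_n x 2 t) (vDerive_n x 3 t).

(* The 1-form omega is [w t dt]; since dx = omega e1, the requirement that e1
   be a positive multiple of dx/dt is [0 < w t]. *)
Record affine_frame (I : R -> Prop) (x e1 e2 e3 : R -> V3) (w l m : R -> R) : Prop := {
  frame_smooth_e1 : vsmooth_on I e1;
  frame_smooth_e2 : vsmooth_on I e2;
  frame_smooth_e3 : vsmooth_on I e3;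
  frame_smooth_w : smooth_on I w;
  frame_smooth_l : smooth_on I l;
  frame_smooth_m : smooth_on I m;
  frame_indep : forall t : R, I t -> lin_indep (e1 t) (e2 t) (e3 t);
  frame_w_pos : forall t : R, I t -> 0 < w t;
  frame_dx : forall t : R, I t -> is_derive x t (scal (w t) (e1 t));
  frame_de1 : forall t : R, I t -> is_derive e1 t (scal (w t) (e2 t));
  frame_de2 : forall t : R, I t -> is_derive e2 t (scal (w t) (e3 t));
  frame_de3 : forall t : R, I t ->
    is_derive e3 t (plus (scal (- m t * w t) (e1 t)) (scal (- l t * w t) (e2 t)))
}.

(* Frames are unique up to the rescaling by a constant, so this does not depend
   on the frame; neither does [is_length_element] below. *)
Definition affine_inflection (I : R -> Prop) (x : R -> V3) (t : R) : Prop :=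
  exists (e1 e2 e3 : R -> V3) (w l m : R -> R),
    affine_frame I x e1 e2 e3 w l m /\ l t = 0.

Definition without_affine_inflection (I : R -> Prop) (x : R -> V3) : Prop :=
  forall t : R, I t -> ~ affine_inflection I x t.

(* The coefficient of dt in omega_s. *)
Definition length_coef (w l : R -> R) (t : R) : R := sqrt (sign (l t) * l t) * w t.

Definition is_length_element (I : R -> Prop) (x : R -> V3) (sigma : R -> R) : Prop :=
  exists (e1 e2 e3 : R -> V3) (w l m : R -> R),
    affine_frame I x e1 e2 e3 w l m /\
    forall t : R, I t -> sigma t = length_coef w l t.

(* The function df/ds for a parameter s: df = (df/ds) ds. *)
Definition dpar (s f : R -> R) (t : R) : R := Derive f t / Derive s t.

(* [ex_diff_n f n eta t]: all partial derivatives of f of order at most n exist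
   and are continuous at (eta, t). *)
Definition smooth2_on (U : R -> R -> Prop) (f : R -> R -> R) : Prop :=
  forall (n : nat) (eta t : R), U eta t -> ex_diff_n f n eta t.

Record compact_deformation (I : R -> Prop) (x : R -> V3)
    (X : R -> R -> V3) (delta : posreal) (C : R -> Prop) : Prop := {
  deform_smooth :
    let U := fun eta t => Rabs eta < delta /\ I t in
    smooth2_on U (fun eta t => coord1 (X eta t)) /\
    smooth2_on U (fun eta t => coord2 (X eta t)) /\
    smooth2_on U (fun eta t => coord3 (X eta t));
  deform_nondegenerate : forall eta : R, Rabs eta < delta -> nondegenerate I (X eta);
  deform_no_inflection : forall eta : R, Rabs eta < delta ->
    without_affine_inflection I (X eta);
  deform_0 : forall t : R, I t -> X 0 t = x t;
  deform_compact : compact C;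
  deform_domain : forall t : R, C t -> I t;
  deform_support : forall eta t : R, Rabs eta < delta -> I t -> ~ C t -> X eta t = x t
}.

(* The length is taken over any compact interval [u, v] of parameters containing
   C: it is the integral over C when C is an interval, and in general differs
   from it by the length of x over [u, v] minus C, which does not depend on eta. *)
Definition general_affine_extremal (I : R -> Prop) (x : R -> V3) : Prop :=
  forall (X : R -> R -> V3) (delta : posreal) (C : R -> Prop),
    compact_deformation I x X delta C ->
    forall u v : R,
      u <= v ->
      (forall t : R, u <= t <= v -> I t) ->
      (forall t : R, C t -> u <= t <= v) ->
      forall sigma : R -> R -> R,
        (forall eta : R, Rabs eta < delta -> is_length_element I (X eta) (sigma eta)) ->
        is_derive (fun eta : R => RInt (sigma eta) u v) 0 0.

(* Main.v *)
Require Import Defs.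
From Stdlib Require Import Reals Lra Lia.
From Coquelicot Require Import Coquelicot.
Open Scope R_scope.

(** Let [s] be the general-affine length parameter of [x]. Every curve [y] of a
    deformation is differentiated with respect to this same [s]. Writing [y_j] for the
    [j]-th derivative and [[ijk]] for [det (y_i, y_j, y_k)], put
    [G = 5/3 [134]/[123] + 2/3 [125]/[123] - 35/36 ([124]/[123])^2].
    Expanding the [y_j] in an affine frame of [y], the derivatives of [omega/ds] cancel
    and [G = l (omega/ds)^2] ([frame_curv]). Hence the length element of [y] is
    [sqrt |G| ds] ([length_coef_curv]), a formula in the derivatives of [y] that contains
    no frame; conversely a curve with [[123]] and [G] nowhere zero has a frame and no
    inflection point ([frame_exists], [is_length_element_of_curv]).

    On [x] itself [G] is the constant [eps]. The frame [E_i = (eps l)^(-i/2) e_i] has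
    structure equations in [s] that only contain [k], [M], [eps]
    ([general_affine_frame_exists]), and in it the first five derivatives of [x] are
    polynomials in [k], [M] and their derivatives ([base_viter]).

    Let [Y] be the velocity of a deformation at [eta = 0]. Since [d/deta] and [d/ds]
    commute ([is_derive_diter]), the length varies by the integral of
    [eps/2 dG(Y) ds], where [dG] is a linear differential operator applied to [Y].
    Integrating by parts gives the pointwise identity
    [eps/2 dG(Y) = EL2 v + EL3 w + dB/ds] ([is_dpar_boundary]), where [v], [w] are the
    components of [Y] along [E2], [E3]: the component along [E1] only moves the
    parameter and contributes to [B] alone. As [Y] has compact support, [B] integrates
    to zero and the derivative of the length is the integral of [(EL2 v + EL3 w) ds]
    ([first_variation]).

    If [EL2 = EL3 = 0] the curve is therefore extremal. Conversely, deforming along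
    [Y = bump (EL2 E2 + EL3 E3)], which is legitimate for small [eta]
    ([displaced_deformation]), the derivative of the length is the integral of
    [bump (EL2^2 + EL3^2) ds], so extremality forces [EL2 = EL3 = 0].

    Finally, with [A1], [A2] the left-hand sides of the two differential equations,
    [EL2 = -5/12 eps A1] and [EL3 = eps/6 dA1/ds + eps/4 k A1 - 3/10 A2], so the two
    systems are equivalent on an interval ([EL_iff_ode]). *)

(** * Smooth functions of one and two variables *)

Definition open2 (U : R -> R -> Prop) : Prop :=
  forall eta t, U eta t -> locally_2d U eta t.

(** The level-[n] form of [smooth2_on], on which the closure properties are proved by
    induction; restricting to an open [U] makes the induction hypothesis apply to
    partial derivatives that are only computed on [U]. *)
Definition diff_on (U : R -> R -> Prop) (n : nat) (f : R -> R -> R) : Prop :=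
  forall eta t, U eta t -> ex_diff_n f n eta t.

Lemma locally_2d_on (U P : R -> R -> Prop) eta t :
  open2 U -> U eta t -> (forall u v, U u v -> P u v) -> locally_2d P eta t.
Proof.
  intros HU Ht HP.
  apply locally_2d_impl with U.
  - apply locally_2d_forall; auto.
  - now apply HU.
Qed.

Lemma diff_on_ext U n f g :
  open2 U -> (forall u v, U u v -> f u v = g u v) -> diff_on U n f -> diff_on U n g.
Proof.
  intros HU Hfg Hf eta t Ht.
  apply ex_diff_n_ext_loc with f; [|now apply Hf].
  now apply (locally_2d_on U).
Qed.

Lemma diff_on_cont U n f eta t : diff_on U n f -> U eta t -> continuity_2d_pt f eta t.
Proof. intros Hf Ht. specialize (Hf eta t Ht). destruct n; apply Hf. Qed.

Lemma diff_on_le U n m f : (m <= n)%nat -> diff_on U n f -> diff_on U m f.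
Proof. intros Hm Hf eta t Ht. now apply ex_diff_n_m with n; auto. Qed.

Lemma diff_on_S U n f :
  diff_on U (S n) f <->
  (forall eta t, U eta t -> continuity_2d_pt f eta t) /\
  (forall eta t, U eta t -> ex_derive (fun z => f z t) eta) /\
  (forall eta t, U eta t -> ex_derive (fun z => f eta z) t) /\
  diff_on U n (fun u v => Derive (fun z => f z v) u) /\
  diff_on U n (fun u v => Derive (fun z => f u z) v).
Proof.
  split.
  - intros Hf; split; [|split; [|split; [|split]]]; intros eta t Ht; apply (Hf eta t Ht).
  - intros (H0 & H1 & H2 & H3 & H4) eta t Ht.
    repeat split; auto.
Qed.

Lemma diff_on_const U n c : open2 U -> diff_on U n (fun _ _ => c).
Proof.
  intros HU; revert c; induction n as [|n IH]; intros c.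
  - intros eta t _; split; [apply continuity_2d_pt_const|trivial].
  - apply diff_on_S; split; [|split; [|split; [|split]]].
    + intros; apply continuity_2d_pt_const.
    + intros; apply ex_derive_const.
    + intros; apply ex_derive_const.
    + apply diff_on_ext with (fun _ _ => 0); auto.
      intros; symmetry; apply Derive_const.
    + apply diff_on_ext with (fun _ _ => 0); auto.
      intros; symmetry; apply Derive_const.
Qed.

Lemma diff_on_plus U n f g :
  open2 U -> diff_on U n f -> diff_on U n g -> diff_on U n (fun u v => f u v + g u v).
Proof.
  intros HU; revert f g; induction n as [|n IH]; intros f g Hf Hg.
  - intros eta t Ht; split; trivial.
    apply continuity_2d_pt_plus; [apply (Hf _ _ Ht)|apply (Hg _ _ Ht)].
  - apply diff_on_S in Hf; apply diff_on_S in Hg.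
    destruct Hf as (F0 & F1 & F2 & F3 & F4), Hg as (G0 & G1 & G2 & G3 & G4).
    apply diff_on_S; split; [|split; [|split; [|split]]].
    + intros; apply continuity_2d_pt_plus; auto.
    + intros eta t Ht; apply @ex_derive_plus; [now apply F1|now apply G1].
    + intros eta t Ht; apply @ex_derive_plus; [now apply F2|now apply G2].
    + apply diff_on_ext with (2 := fun u v Huv => eq_sym (Derive_plus _ _ _ (F1 u v Huv) (G1 u v Huv))); auto.
    + apply diff_on_ext with (2 := fun u v Huv => eq_sym (Derive_plus _ _ _ (F2 u v Huv) (G2 u v Huv))); auto.
Qed.

Lemma diff_on_mult U n f g :
  open2 U -> diff_on U n f -> diff_on U n g -> diff_on U n (fun u v => f u v * g u v).
Proof.
  intros HU; revert f g; induction n as [|n IH]; intros f g Hf Hg.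
  - intros eta t Ht; split; trivial.
    apply continuity_2d_pt_mult; [apply (Hf _ _ Ht)|apply (Hg _ _ Ht)].
  - assert (Hf' := diff_on_le U (S n) n f ltac:(lia) Hf).
    assert (Hg' := diff_on_le U (S n) n g ltac:(lia) Hg).
    apply diff_on_S in Hf; apply diff_on_S in Hg.
    destruct Hf as (F0 & F1 & F2 & F3 & F4), Hg as (G0 & G1 & G2 & G3 & G4).
    apply diff_on_S; split; [|split; [|split; [|split]]].
    + intros; apply continuity_2d_pt_mult; auto.
    + intros eta t Ht; apply ex_derive_mult; [now apply F1|now apply G1].
    + intros eta t Ht; apply ex_derive_mult; [now apply F2|now apply G2].
    + apply diff_on_ext with (2 := fun u v Huv => eq_sym (Derive_mult _ _ _ (F1 u v Huv) (G1 u v Huv))); auto.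
      apply diff_on_plus; auto.
    + apply diff_on_ext with (2 := fun u v Huv => eq_sym (Derive_mult _ _ _ (F2 u v Huv) (G2 u v Huv))); auto.
      apply diff_on_plus; auto.
Qed.

Lemma smooth2_ext U f g :
  open2 U -> (forall u v, U u v -> f u v = g u v) -> smooth2_on U f -> smooth2_on U g.
Proof. intros HU Hfg Hf n. apply (diff_on_ext U n f g HU Hfg (Hf n)). Qed.

Lemma smooth2_cont U f eta t : smooth2_on U f -> U eta t -> continuity_2d_pt f eta t.
Proof. intros Hf. exact (diff_on_cont U 0 f eta t (Hf 0%nat)). Qed.

Lemma smooth2_ex_derive1 U f eta t :
  smooth2_on U f -> U eta t -> ex_derive (fun z => f z t) eta.
Proof. intros Hf Ht. apply (Hf 1%nat eta t Ht). Qed.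

Lemma smooth2_ex_derive2 U f eta t : smooth2_on U f -> U eta t -> ex_derive (f eta) t.
Proof. intros Hf Ht. apply (Hf 1%nat eta t Ht). Qed.

Lemma smooth2_Derive1 U f :
  smooth2_on U f -> smooth2_on U (fun u v => Derive (fun z => f z v) u).
Proof. intros Hf n eta t Ht. apply (Hf (S n) eta t Ht). Qed.

Lemma smooth2_Derive2 U f :
  smooth2_on U f -> smooth2_on U (fun u v => Derive (f u) v).
Proof. intros Hf n eta t Ht. apply (Hf (S n) eta t Ht). Qed.

Lemma smooth2_const U c : open2 U -> smooth2_on U (fun _ _ => c).
Proof. intros HU n. now apply diff_on_const. Qed.

Lemma smooth2_plus U f g :
  open2 U -> smooth2_on U f -> smooth2_on U g -> smooth2_on U (fun u v => f u v + g u v).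
Proof. intros HU Hf Hg n. exact (diff_on_plus U n f g HU (Hf n) (Hg n)). Qed.

Lemma smooth2_mult U f g :
  open2 U -> smooth2_on U f -> smooth2_on U g -> smooth2_on U (fun u v => f u v * g u v).
Proof. intros HU Hf Hg n. exact (diff_on_mult U n f g HU (Hf n) (Hg n)). Qed.

Lemma smooth2_opp U f :
  open2 U -> smooth2_on U f -> smooth2_on U (fun u v => - f u v).
Proof.
  intros HU Hf. apply smooth2_ext with (fun u v => (-1) * f u v); auto.
  - intros; ring.
  - apply smooth2_mult; auto. now apply smooth2_const.
Qed.

Lemma smooth2_minus U f g :
  open2 U -> smooth2_on U f -> smooth2_on U g -> smooth2_on U (fun u v => f u v - g u v).
Proof. intros HU Hf Hg. apply smooth2_plus, smooth2_opp; auto. Qed.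

Lemma smooth_Derive I f : smooth_on I f -> smooth_on I (Derive f).
Proof.
  intros Hf n t Ht. destruct n as [|n]; [exact Logic.I|].
  change (ex_derive (Derive_n (Derive_n f 1) n) t).
  apply ex_derive_ext with (Derive_n f (n + 1)).
  - intros z. symmetry. apply Derive_n_comp.
  - rewrite PeanoNat.Nat.add_1_r. apply (Hf (S (S n)) t Ht).
Qed.

Lemma smooth_ex_derive I f t : smooth_on I f -> I t -> ex_derive f t.
Proof. intros Hf Ht. apply (Hf 1%nat t Ht). Qed.

Lemma smooth_cont I f t : smooth_on I f -> I t -> continuity_pt f t.
Proof.
  intros Hf Ht. apply continuity_pt_filterlim, @ex_derive_continuous.
  now apply (smooth_ex_derive I).
Qed.

Lemma smooth_is_derive I f t : smooth_on I f -> I t -> is_derive f t (Derive f t).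
Proof. intros Hf Ht. now apply Derive_correct, (smooth_ex_derive I). Qed.

(** By the chain rule both partial derivatives of [h (f u v)] are products of a derivative
    of [f] and of [h' (f u v)], to which the induction hypothesis applies with [h'] for [h]. *)
Lemma smooth2_comp U (J : R -> Prop) h f :
  open2 U -> smooth_on J h -> (forall u v, U u v -> J (f u v)) ->
  smooth2_on U f -> smooth2_on U (fun u v => h (f u v)).
Proof.
  intros HU Hh HJ Hf n. revert h Hh.
  induction n as [|n IH]; intros h Hh.
  - intros eta t Ht; split; trivial.
    apply continuity_1d_2d_pt_comp.
    + apply (smooth_cont J); auto.
    + now apply (smooth2_cont U).
  - assert (D1 : forall u v, U u v ->
        is_derive (fun z => h (f z v)) u (Derive (fun z => f z v) u * Derive h (f u v))).
    { intros u v Huv. apply (is_derive_comp h (fun z => f z v)).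
      - apply (smooth_is_derive J); auto.
      - apply Derive_correct. now apply (smooth2_ex_derive1 U). }
    assert (D2 : forall u v, U u v ->
        is_derive (fun z => h (f u z)) v (Derive (f u) v * Derive h (f u v))).
    { intros u v Huv. apply (is_derive_comp h (f u)).
      - apply (smooth_is_derive J); auto.
      - apply Derive_correct. now apply (smooth2_ex_derive2 U). }
    apply diff_on_S; split; [|split; [|split; [|split]]].
    + intros eta t Ht. apply continuity_1d_2d_pt_comp.
      * apply (smooth_cont J); auto.
      * now apply (smooth2_cont U).
    + intros u v Huv. eexists; now apply D1.
    + intros u v Huv. eexists; now apply D2.
    + apply diff_on_ext with (2 := fun u v Huv => eq_sym (is_derive_unique _ _ _ (D1 u v Huv))); auto.
      apply diff_on_mult; auto.
      * exact (smooth2_Derive1 U f Hf n).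
      * refine (IH (Derive h) _). now apply smooth_Derive.
    + apply diff_on_ext with (2 := fun u v Huv => eq_sym (is_derive_unique _ _ _ (D2 u v Huv))); auto.
      apply diff_on_mult; auto.
      * exact (smooth2_Derive2 U f Hf n).
      * refine (IH (Derive h) _). now apply smooth_Derive.
Qed.

(** Restricting to a line [eta = const] and extending by a constant in [eta] carry
    the closure properties of smooth functions over to one variable. *)
Lemma smooth2_slice U f eta : smooth2_on U f -> smooth_on (U eta) (f eta).
Proof.
  intros Hf n. revert f Hf.
  induction n as [|n IH]; intros f Hf t Ht; [exact Logic.I|].
  destruct n as [|n].
  - now apply (smooth2_ex_derive2 U).
  - change (ex_derive (Derive_n (f eta) (S n)) t).
    apply ex_derive_ext with (Derive_n (Derive_n (f eta) 1) n).
    + intros z. rewrite Derive_n_comp, PeanoNat.Nat.add_1_r. reflexivity.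
    + apply (IH (fun u v => Derive (f u) v) (smooth2_Derive2 U f Hf) t Ht).
Qed.

Lemma smooth2_lift (U : R -> R -> Prop) I f :
  open2 U -> (forall eta t, U eta t -> I t) -> smooth_on I f -> smooth2_on U (fun _ t => f t).
Proof.
  intros HU HI Hf n. revert f Hf.
  induction n as [|n IH]; intros f Hf.
  - intros eta t Ht; split; trivial.
    apply (continuity_1d_2d_pt_comp f (fun _ v => v)).
    + apply (smooth_cont I); eauto.
    + apply continuity_2d_pt_id2.
  - apply diff_on_S; split; [|split; [|split; [|split]]].
    + intros eta t Ht. apply (continuity_1d_2d_pt_comp f (fun _ v => v)).
      * apply (smooth_cont I); eauto.
      * apply continuity_2d_pt_id2.
    + intros; apply ex_derive_const.
    + intros eta t Ht. apply (smooth_ex_derive I); eauto.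
    + apply diff_on_ext with (fun _ _ => 0); auto.
      * intros; symmetry; apply Derive_const.
      * now apply diff_on_const.
    + refine (IH (Derive f) _). now apply smooth_Derive.
Qed.

Lemma open2_strip (I : R -> Prop) : open I -> open2 (fun _ t => I t).
Proof.
  intros HI eta t Ht. destruct (HI t Ht) as [d Hd].
  exists d; intros u v _ Hv. now apply Hd.
Qed.

Section OneVariable.
Context (I : R -> Prop) (HI : open I).

Lemma smooth_via2 (f : R -> R) : smooth2_on (fun _ t => I t) (fun _ t => f t) -> smooth_on I f.
Proof. exact (smooth2_slice _ (fun _ t => f t) 0). Qed.

Lemma smooth_lift f : smooth_on I f -> smooth2_on (fun _ t => I t) (fun _ t => f t).
Proof. apply smooth2_lift; auto. now apply open2_strip. Qed.

Lemma smooth_ext f g : (forall t, I t -> f t = g t) -> smooth_on I f -> smooth_on I g.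
Proof.
  intros Hfg Hf n t Ht. apply ex_derive_n_ext_loc with f; [|now apply Hf].
  apply filter_imp with I; [exact Hfg|now apply HI].
Qed.

Lemma smooth_const c : smooth_on I (fun _ => c).
Proof. now apply smooth_via2, smooth2_const, open2_strip. Qed.

Lemma smooth_plus f g : smooth_on I f -> smooth_on I g -> smooth_on I (fun t => f t + g t).
Proof.
  intros Hf Hg. apply smooth_via2.
  apply (smooth2_plus _ (fun _ t => f t) (fun _ t => g t));
    [now apply open2_strip | now apply smooth_lift | now apply smooth_lift].
Qed.

Lemma smooth_mult f g : smooth_on I f -> smooth_on I g -> smooth_on I (fun t => f t * g t).
Proof.
  intros Hf Hg. apply smooth_via2.
  apply (smooth2_mult _ (fun _ t => f t) (fun _ t => g t));
    [now apply open2_strip | now apply smooth_lift | now apply smooth_lift].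
Qed.

Lemma smooth_opp f : smooth_on I f -> smooth_on I (fun t => - f t).
Proof.
  intros Hf. apply smooth_via2.
  apply (smooth2_opp _ (fun _ t => f t)); [now apply open2_strip | now apply smooth_lift].
Qed.

Lemma smooth_minus f g : smooth_on I f -> smooth_on I g -> smooth_on I (fun t => f t - g t).
Proof. intros Hf Hg. apply smooth_plus; [|apply smooth_opp]; auto. Qed.

Lemma smooth_comp (J : R -> Prop) h f :
  smooth_on J h -> (forall t, I t -> J (f t)) -> smooth_on I f -> smooth_on I (fun t => h (f t)).
Proof.
  intros Hh HJ Hf. apply smooth_via2.
  apply (smooth2_comp _ J h (fun _ t => f t)); auto;
    [now apply open2_strip | now apply smooth_lift].
Qed.
End OneVariable.

Lemma smooth_id I : smooth_on I (fun t => t).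
Proof.
  intros n t _. destruct n as [|[|n]]; [exact Logic.I|apply ex_derive_id|].
  change (ex_derive (Derive_n (fun t => t) (S n)) t).
  apply ex_derive_ext with (fun z => Derive_n (fun _ => 1) n z).
  - intros z. rewrite <- PeanoNat.Nat.add_1_r, <- Derive_n_comp.
    apply Derive_n_ext; intros; symmetry; apply Derive_id.
  - apply (smooth_const (fun _ => True) open_true 1 (S n) t Logic.I).
Qed.

(** A family of functions whose derivatives are combinations of two members of the
    family consists of smooth functions; this covers the real powers and the
    flat functions used below. *)
Lemma smooth_family (T : Type) (I : R -> Prop) (h : T -> R -> R)
    (next1 next2 : T -> T) (c1 c2 : T -> R) :
  open I ->
  (forall i t, I t ->
     is_derive (h i) t (c1 i * h (next1 i) t + c2 i * h (next2 i) t)) ->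
  forall i, smooth_on I (h i).
Proof.
  intros HI Hd i n.
  enough (H : forall m, (m <= n)%nat -> forall i t, I t -> ex_derive_n (h i) m t)
    by (intros t; now apply H).
  clear i. induction n as [|n IH]; intros m Hm i t Ht.
  - now replace m with 0%nat by lia.
  - destruct (Nat.eq_dec m (S n)) as [->|]; [|apply IH; auto; lia].
    destruct n as [|n]; [eexists; now apply Hd|].
    change (ex_derive (Derive_n (h i) (S n)) t).
    apply ex_derive_ext with (Derive_n (Derive_n (h i) 1) n).
    { intros z. rewrite Derive_n_comp, Nat.add_1_r. reflexivity. }
    change (ex_derive_n (Derive (h i)) (S n) t).
    apply ex_derive_n_ext_loc with (fun t => c1 i * h (next1 i) t + c2 i * h (next2 i) t).
    { apply filter_imp with I; [|now apply HI].
      intros z Hz. symmetry. now apply is_derive_unique, Hd. }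
    apply ex_derive_n_plus; (apply filter_imp with I; [|now apply HI]);
      intros z Hz k Hk; apply ex_derive_n_scal_l, IH; auto.
Qed.

Lemma smooth_Rpower c : smooth_on (fun x => 0 < x) (fun x => Rpower x c).
Proof.
  apply (smooth_family R (fun x => 0 < x) (fun c x => Rpower x c)
           (fun c => c - 1) (fun c => c) (fun c => c) (fun _ => 0)).
  - apply open_gt.
  - intros e t Ht. rewrite Rmult_0_l, Rplus_0_r.
    apply is_derive_Reals. now apply derivable_pt_lim_power.
Qed.

(** Lets the inverse of a function of either sign be obtained from the real powers of a
    positive function. *)
Lemma inv_Rpower x : x <> 0 -> x * Rpower (x * x) (-1) = / x.
Proof.
  intros Hx. assert (0 < x * x) by nra.
  replace (-1) with (- (1)) by ring. rewrite Rpower_Ropp, Rpower_1 by assumption. now field.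
Qed.

Lemma smooth2_Rpower U c f :
  open2 U -> (forall u v, U u v -> 0 < f u v) -> smooth2_on U f ->
  smooth2_on U (fun u v => Rpower (f u v) c).
Proof.
  intros HU Hpos Hf.
  apply (smooth2_comp U (fun x => 0 < x) (fun x => Rpower x c)); auto.
  apply smooth_Rpower.
Qed.

Lemma smooth2_inv U f :
  open2 U -> (forall u v, U u v -> f u v <> 0) -> smooth2_on U f ->
  smooth2_on U (fun u v => / f u v).
Proof.
  intros HU Hf0 Hf.
  apply smooth2_ext with (fun u v => f u v * Rpower (f u v * f u v) (-1)); auto.
  - intros u v Huv; now apply inv_Rpower, Hf0.
  - apply smooth2_mult; auto. apply smooth2_Rpower; auto.
    + intros u v Huv; specialize (Hf0 u v Huv); nra.
    + now apply smooth2_mult.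
Qed.

Lemma smooth2_div U f g :
  open2 U -> (forall u v, U u v -> g u v <> 0) -> smooth2_on U f -> smooth2_on U g ->
  smooth2_on U (fun u v => f u v / g u v).
Proof. intros. apply smooth2_mult, smooth2_inv; auto. Qed.

Lemma smooth_pow I c f :
  open I -> (forall t, I t -> 0 < f t) -> smooth_on I f ->
  smooth_on I (fun t => Rpower (f t) c).
Proof.
  intros HI Hpos Hf. apply (smooth_comp I HI (fun x => 0 < x) (fun x => Rpower x c)); auto.
  apply smooth_Rpower.
Qed.

Lemma smooth_div I f g :
  open I -> (forall t, I t -> g t <> 0) -> smooth_on I f -> smooth_on I g ->
  smooth_on I (fun t => f t / g t).
Proof.
  intros HI Hg0 Hf Hg. apply smooth_via2.
  apply (smooth2_div _ (fun _ t => f t) (fun _ t => g t));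
    [now apply open2_strip | auto | now apply smooth_lift | now apply smooth_lift].
Qed.

Ltac smooth :=
  lazymatch goal with
  | |- smooth_on ?I (fun _ => ?c) => apply smooth_const; assumption
  | |- smooth_on ?I (fun z => @?f z + @?g z) => apply (smooth_plus I ltac:(assumption) f g); smooth
  | |- smooth_on ?I (fun z => @?f z - @?g z) => apply (smooth_minus I ltac:(assumption) f g); smooth
  | |- smooth_on ?I (fun z => @?f z * @?g z) => apply (smooth_mult I ltac:(assumption) f g); smooth
  | |- smooth_on ?I (fun z => - @?f z) => apply (smooth_opp I ltac:(assumption) f); smooth
  | |- smooth2_on ?U (fun _ _ => ?c) => apply smooth2_const; assumption
  | |- smooth2_on ?U (fun u v => @?f u v + @?g u v) => apply (smooth2_plus U f g ltac:(assumption)); smooth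
  | |- smooth2_on ?U (fun u v => @?f u v - @?g u v) => apply (smooth2_minus U f g ltac:(assumption)); smooth
  | |- smooth2_on ?U (fun u v => @?f u v * @?g u v) => apply (smooth2_mult U f g ltac:(assumption)); smooth
  | |- _ => try assumption
  end.

(** * Vectors and determinants *)

Definition vec (a b c : R) : V3 := ((a, b), c).

Definition det (u v w : V3) : R :=
  coord1 u * (coord2 v * coord3 w - coord3 v * coord2 w)
  - coord2 u * (coord1 v * coord3 w - coord3 v * coord1 w)
  + coord3 u * (coord1 v * coord2 w - coord2 v * coord1 w).

Definition lin_comb (u v w : V3) (c : V3) : V3 :=
  vec (coord1 c * coord1 u + coord2 c * coord1 v + coord3 c * coord1 w)
      (coord1 c * coord2 u + coord2 c * coord2 v + coord3 c * coord2 w)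
      (coord1 c * coord3 u + coord2 c * coord3 v + coord3 c * coord3 w).

Lemma V3_eq (u v : V3) :
  coord1 u = coord1 v -> coord2 u = coord2 v -> coord3 u = coord3 v -> u = v.
Proof.
  destruct u as [[u1 u2] u3], v as [[v1 v2] v3]; cbn; congruence.
Qed.

Lemma coord_vec a b c :
  coord1 (vec a b c) = a /\ coord2 (vec a b c) = b /\ coord3 (vec a b c) = c.
Proof. now repeat split. Qed.

Lemma coord_plus (u v : V3) :
  coord1 (plus u v) = coord1 u + coord1 v /\ coord2 (plus u v) = coord2 u + coord2 v /\
  coord3 (plus u v) = coord3 u + coord3 v.
Proof. now repeat split. Qed.

Lemma coord_scal a (u : V3) :
  coord1 (scal a u) = a * coord1 u /\ coord2 (scal a u) = a * coord2 u /\
  coord3 (scal a u) = a * coord3 u.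
Proof. now repeat split. Qed.

Lemma coord_lin_comb u v w c :
  coord1 (lin_comb u v w c) = coord1 c * coord1 u + coord2 c * coord1 v + coord3 c * coord1 w /\
  coord2 (lin_comb u v w c) = coord1 c * coord2 u + coord2 c * coord2 v + coord3 c * coord2 w /\
  coord3 (lin_comb u v w c) = coord1 c * coord3 u + coord2 c * coord3 v + coord3 c * coord3 w.
Proof. now repeat split. Qed.

Ltac coord :=
  repeat first
    [ rewrite (proj1 (coord_vec _ _ _)) | rewrite (proj1 (proj2 (coord_vec _ _ _)))
    | rewrite (proj2 (proj2 (coord_vec _ _ _)))
    | rewrite (proj1 (coord_plus _ _)) | rewrite (proj1 (proj2 (coord_plus _ _)))
    | rewrite (proj2 (proj2 (coord_plus _ _)))
    | rewrite (proj1 (coord_scal _ _)) | rewrite (proj1 (proj2 (coord_scal _ _)))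
    | rewrite (proj2 (proj2 (coord_scal _ _)))
    | rewrite (proj1 (coord_lin_comb _ _ _ _)) | rewrite (proj1 (proj2 (coord_lin_comb _ _ _ _)))
    | rewrite (proj2 (proj2 (coord_lin_comb _ _ _ _))) ].

Ltac vec_field := apply V3_eq; coord; field.

Lemma det_lin_comb u v w a b c :
  det (lin_comb u v w a) (lin_comb u v w b) (lin_comb u v w c) = det a b c * det u v w.
Proof. unfold det, lin_comb, vec, coord1, coord2, coord3; cbn; ring. Qed.

Lemma det_lin_comb1 u v w a :
  det (lin_comb u v w a) v w = coord1 a * det u v w /\
  det u (lin_comb u v w a) w = coord2 a * det u v w /\
  det u v (lin_comb u v w a) = coord3 a * det u v w.
Proof.
  repeat split; unfold det, lin_comb, vec; cbn [coord1 coord2 coord3 fst snd]; ring.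
Qed.

Lemma det_lin_comb2 u v w a b :
  det (lin_comb u v w a) (lin_comb u v w b) w
    = (coord1 a * coord2 b - coord2 a * coord1 b) * det u v w /\
  det (lin_comb u v w a) v (lin_comb u v w b)
    = (coord1 a * coord3 b - coord3 a * coord1 b) * det u v w /\
  det u (lin_comb u v w a) (lin_comb u v w b)
    = (coord2 a * coord3 b - coord3 a * coord2 b) * det u v w.
Proof.
  repeat split; unfold det, lin_comb, vec; cbn [coord1 coord2 coord3 fst snd]; ring.
Qed.

Lemma lin_comb_eq (u v w c : V3) :
  plus (plus (scal (coord1 c) u) (scal (coord2 c) v)) (scal (coord3 c) w) = lin_comb u v w c.
Proof. reflexivity. Qed.

(** If the determinant vanishes, the columns of the cofactor matrix are linear relations
    between [u], [v], [w]; they cannot all be trivial. *)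
Lemma lin_indep_det u v w : lin_indep u v w <-> det u v w <> 0.
Proof.
  split.
  - intros H Hd.
    assert (K : forall c : V3, lin_comb u v w c = (zero : V3) -> c = vec 0 0 0).
    { intros c Hc. destruct (H (coord1 c) (coord2 c) (coord3 c)) as (H1 & H2 & H3).
      - now rewrite lin_comb_eq.
      - now apply V3_eq. }
    assert (C3 : coord1 u * coord2 v - coord2 u * coord1 v = 0 /\
                 coord1 u * coord3 v - coord3 u * coord1 v = 0 /\
                 coord2 u * coord3 v - coord3 u * coord2 v = 0).
    { repeat split.
      - apply (f_equal coord3 (K (vec (coord1 v * coord2 w - coord2 v * coord1 w)
             (- (coord1 u * coord2 w - coord2 u * coord1 w))
             (coord1 u * coord2 v - coord2 u * coord1 v)) ltac:(
             apply V3_eq; unfold det in Hd; cbn in *; lra))).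
      - apply (f_equal coord3 (K (vec (coord1 v * coord3 w - coord3 v * coord1 w)
             (- (coord1 u * coord3 w - coord3 u * coord1 w))
             (coord1 u * coord3 v - coord3 u * coord1 v)) ltac:(
             apply V3_eq; unfold det in Hd; cbn in *; lra))).
      - apply (f_equal coord3 (K (vec (coord2 v * coord3 w - coord3 v * coord2 w)
             (- (coord2 u * coord3 w - coord3 u * coord2 w))
             (coord2 u * coord3 v - coord3 u * coord2 v)) ltac:(
             apply V3_eq; unfold det in Hd; cbn in *; lra))). }
    destruct C3 as (C12 & C13 & C23).
    assert (U1 := f_equal coord2 (K (vec (coord1 v) (- coord1 u) 0) ltac:(apply V3_eq; cbn in *; lra))).
    assert (U2 := f_equal coord2 (K (vec (coord2 v) (- coord2 u) 0) ltac:(apply V3_eq; cbn in *; lra))).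
    assert (U3 := f_equal coord2 (K (vec (coord3 v) (- coord3 u) 0) ltac:(apply V3_eq; cbn in *; lra))).
    assert (U4 := f_equal coord1 (K (vec 1 0 0) ltac:(apply V3_eq; cbn in *; lra))).
    cbn in U4; lra.
  - intros Hd a b c H.
    change (lin_comb u v w (vec a b c) = vec 0 0 0) in H.
    assert (H1 := f_equal coord1 H); assert (H2 := f_equal coord2 H); assert (H3 := f_equal coord3 H).
    unfold det in Hd.
    destruct u as [[u1 u2] u3], v as [[v1 v2] v3], w as [[w1 w2] w3].
    cbn in H1, H2, H3, Hd.
    (* Cramer's rule *)
    repeat split; apply (Rmult_eq_reg_r _ _ _) with (2 := Hd).
    + transitivity ((a*u1+b*v1+c*w1)*(v2*w3-v3*w2) - (a*u2+b*v2+c*w2)*(v1*w3-v3*w1)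
         + (a*u3+b*v3+c*w3)*(v1*w2-v2*w1)); [ring|].
      rewrite H1, H2, H3; ring.
    + transitivity (- (a*u1+b*v1+c*w1)*(u2*w3-u3*w2) + (a*u2+b*v2+c*w2)*(u1*w3-u3*w1)
         - (a*u3+b*v3+c*w3)*(u1*w2-u2*w1)); [ring|].
      rewrite H1, H2, H3; ring.
    + transitivity ((a*u1+b*v1+c*w1)*(u2*v3-u3*v2) - (a*u2+b*v2+c*w2)*(u1*v3-u3*v1)
         + (a*u3+b*v3+c*w3)*(u1*v2-u2*v1)); [ring|].
      rewrite H1, H2, H3; ring.
Qed.

(** Cramer's formulas. *)
Definition coords (u v w x : V3) : V3 :=
  vec (det x v w / det u v w) (det u x w / det u v w) (det u v x / det u v w).

Lemma lin_comb_coords u v w x : det u v w <> 0 -> lin_comb u v w (coords u v w x) = x.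
Proof.
  intros H. unfold det in H.
  apply V3_eq; unfold lin_comb, coords, vec, det; cbn [coord1 coord2 coord3 fst snd]; now field.
Qed.

(** ** Derivatives of vector-valued functions *)

(** A linear projection maps derivatives to derivatives; conversely the pairing of two
    differentiable functions is differentiable because pairing is itself linear. *)
Lemma is_derive_V3 (x : R -> V3) (t : R) (v : V3) :
  is_derive x t v <->
  is_derive (fun u => coord1 (x u)) t (coord1 v) /\
  is_derive (fun u => coord2 (x u)) t (coord2 v) /\
  is_derive (fun u => coord3 (x u)) t (coord3 v).
Proof.
  split.
  - intros H.
    assert (L : forall c : V3 -> R_NormedModule, is_linear c ->
        filterdiff (fun u => c (x u)) (locally t) (fun y : R_NormedModule => c (scal y v))).
    { intros c Hc. apply (filterdiff_comp' x c t (fun y => scal y v) c); [exact H|].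
      now apply filterdiff_linear. }
    assert (Lfst : @is_linear R_AbsRing V3 (prod_NormedModule R_AbsRing R_NormedModule R_NormedModule)
                     (fun z => fst z)) by apply is_linear_fst.
    split; [|split].
    + refine (L coord1 _). apply (is_linear_comp _ _ Lfst). apply is_linear_fst.
    + refine (L coord2 _). apply (is_linear_comp _ _ Lfst). apply is_linear_snd.
    + refine (L coord3 _). apply is_linear_snd.
  - intros (H1 & H2 & H3).
    apply filterdiff_ext with (fun u => ((coord1 (x u), coord2 (x u)), coord3 (x u))).
    { intros u. now destruct (x u) as [[a b] c]. }
    apply filterdiff_ext_lin with (fun y => ((y * coord1 v, y * coord2 v), y * coord3 v)).
    2:{ intros y. now destruct v as [[a b] c]. }
    assert (P : forall (A B : NormedModule R_AbsRing) (f lf : R -> A) (g lg : R -> B),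
      filterdiff f (locally t) lf -> filterdiff g (locally t) lg ->
      filterdiff (fun u => (f u, g u)) (locally t) (fun u => (lf u, lg u))).
    { intros A B f lf g lg Hf Hg.
      apply (filterdiff_comp'_2 f g (fun a b => (a, b)) t lf lg (fun a b => (a, b))); auto.
      apply filterdiff_ext with (fun z => z).
      - now intros [a b].
      - apply filterdiff_ext_lin with (fun z => z).
        + apply filterdiff_id.
        + now intros [a b]. }
    apply (P (prod_NormedModule R_AbsRing R_NormedModule R_NormedModule) R_NormedModule);
      [apply (P R_NormedModule R_NormedModule)|]; assumption.
Qed.

(** * Differentiation with respect to a parameter [s] *)

(** [df = d ds], written without dividing by [ds/dt]. *)
Definition is_dpar (s f : R -> R) (t d : R) : Prop := is_derive f t (Derive s t * d).

Lemma is_dpar_eq s f t d d' : is_dpar s f t d -> d = d' -> is_dpar s f t d'.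
Proof. now intros H <-. Qed.

Lemma is_dpar_const s c t : is_dpar s (fun _ => c) t 0.
Proof. unfold is_dpar. rewrite Rmult_0_r. apply @is_derive_const. Qed.

Lemma is_dpar_plus s f g t df dg :
  is_dpar s f t df -> is_dpar s g t dg -> is_dpar s (fun z => f z + g z) t (df + dg).
Proof.
  unfold is_dpar. intros Hf Hg. rewrite Rmult_plus_distr_l. now apply @is_derive_plus.
Qed.

Lemma is_dpar_opp s f t df : is_dpar s f t df -> is_dpar s (fun z => - f z) t (- df).
Proof.
  unfold is_dpar. intros Hf. replace (Derive s t * - df) with (- (Derive s t * df)) by ring.
  now apply @is_derive_opp.
Qed.

Lemma is_dpar_minus s f g t df dg :
  is_dpar s f t df -> is_dpar s g t dg -> is_dpar s (fun z => f z - g z) t (df - dg).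
Proof. intros Hf Hg. now apply is_dpar_plus; [|apply is_dpar_opp]. Qed.

Lemma is_dpar_mult s f g t df dg :
  is_dpar s f t df -> is_dpar s g t dg ->
  is_dpar s (fun z => f z * g z) t (df * g t + f t * dg).
Proof.
  unfold is_dpar. intros Hf Hg.
  replace (Derive s t * _) with ((Derive s t * df) * g t + f t * (Derive s t * dg)) by ring.
  apply (is_derive_mult f g t); auto. intros; apply Rmult_comm.
Qed.

Lemma is_dpar_div s f g t df dg :
  g t <> 0 -> is_dpar s f t df -> is_dpar s g t dg ->
  is_dpar s (fun z => f z / g z) t ((df * g t - f t * dg) / (g t * g t)).
Proof.
  unfold is_dpar. intros Hg0 Hf Hg.
  replace (Derive s t * _) with
    ((Derive s t * df * g t - f t * (Derive s t * dg)) / g t ^ 2) by (now field).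
  now apply is_derive_div.
Qed.

Definition is_vdpar (s : R -> R) (y : R -> V3) (t : R) (v : V3) : Prop :=
  is_dpar s (fun z => coord1 (y z)) t (coord1 v) /\
  is_dpar s (fun z => coord2 (y z)) t (coord2 v) /\
  is_dpar s (fun z => coord3 (y z)) t (coord3 v).

Ltac dpar :=
  lazymatch goal with
  | |- is_dpar _ (fun z => @?f z + @?g z) _ _ => eapply (is_dpar_plus _ f g); dpar
  | |- is_dpar _ (fun z => @?f z - @?g z) _ _ => eapply (is_dpar_minus _ f g); dpar
  | |- is_dpar _ (fun z => @?f z * @?g z) _ _ => eapply (is_dpar_mult _ f g); dpar
  | |- is_dpar _ (fun z => - @?f z) _ _ => eapply (is_dpar_opp _ f); dpar
  | |- is_dpar _ (fun _ => ?c) _ _ => eapply (is_dpar_const _ c)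
  | |- is_dpar ?s (fun z => ?f z) ?t ?d => change (is_dpar s f t d); eauto
  | |- _ => eauto
  end.

Ltac dpar_by tac := eapply is_dpar_eq; [dpar | cbv beta; tac].

Lemma is_vdpar_eq s y t v v' : is_vdpar s y t v -> v = v' -> is_vdpar s y t v'.
Proof. now intros H <-. Qed.

Lemma is_vdpar_plus s y z t dy dz :
  is_vdpar s y t dy -> is_vdpar s z t dz ->
  is_vdpar s (fun u => plus (y u) (z u)) t (plus dy dz).
Proof.
  intros (Y1 & Y2 & Y3) (Z1 & Z2 & Z3).
  split; [exact (is_dpar_plus _ _ _ _ _ _ Y1 Z1)|].
  split; [exact (is_dpar_plus _ _ _ _ _ _ Y2 Z2)|exact (is_dpar_plus _ _ _ _ _ _ Y3 Z3)].
Qed.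

Lemma is_vdpar_scal s f y t df dy :
  is_dpar s f t df -> is_vdpar s y t dy ->
  is_vdpar s (fun u => scal (f u) (y u)) t (plus (scal df (y t)) (scal (f t) dy)).
Proof.
  intros Hf (Y1 & Y2 & Y3).
  split; [exact (is_dpar_mult _ _ _ _ _ _ Hf Y1)|].
  split; [exact (is_dpar_mult _ _ _ _ _ _ Hf Y2)|exact (is_dpar_mult _ _ _ _ _ _ Hf Y3)].
Qed.

Lemma is_dpar_det s u v w t du dv dw :
  is_vdpar s u t du -> is_vdpar s v t dv -> is_vdpar s w t dw ->
  is_dpar s (fun z => det (u z) (v z) (w z)) t
    (det du (v t) (w t) + det (u t) dv (w t) + det (u t) (v t) dw).
Proof.
  intros (? & ? & ?) (? & ? & ?) (? & ? & ?). unfold det at 1.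
  dpar_by ltac:(unfold det; ring).
Qed.

Fixpoint diter (s : R -> R) (j : nat) (f : R -> R) : R -> R :=
  match j with O => f | S j => dpar s (diter s j f) end.

Definition viter (s : R -> R) (j : nat) (x : R -> V3) (t : R) : V3 :=
  vec (diter s j (fun u => coord1 (x u)) t)
      (diter s j (fun u => coord2 (x u)) t)
      (diter s j (fun u => coord3 (x u)) t).

Section Reparametrization.
Context (I : R -> Prop) (s : R -> R).
Context (HI : open I) (Hs : smooth_on I (Derive s)) (Hs0 : forall t, I t -> 0 < Derive s t).

Lemma dpar_unique f t d : I t -> is_dpar s f t d -> dpar s f t = d.
Proof.
  intros Ht H. unfold dpar. rewrite (is_derive_unique _ _ _ H).
  field. specialize (Hs0 t Ht); lra.
Qed.

Lemma dpar_correct f t : I t -> ex_derive f t -> is_dpar s f t (dpar s f t).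
Proof.
  intros Ht Hf. unfold is_dpar, dpar.
  replace (Derive s t * _) with (Derive f t) by (field; specialize (Hs0 t Ht); lra).
  now apply Derive_correct.
Qed.

Lemma smooth_dpar f : smooth_on I f -> smooth_on I (dpar s f).
Proof.
  intros Hf. apply smooth_div; auto.
  - intros t Ht; specialize (Hs0 t Ht); lra.
  - now apply smooth_Derive.
Qed.

Lemma smooth_is_dpar f t : smooth_on I f -> I t -> is_dpar s f t (dpar s f t).
Proof. intros Hf Ht. apply dpar_correct; auto. now apply (smooth_ex_derive I). Qed.

Lemma smooth_diter j f : smooth_on I f -> smooth_on I (diter s j f).
Proof. intros Hf. induction j as [|j IH]; [exact Hf|now apply smooth_dpar]. Qed.

Lemma is_dpar_ext f g t d :
  (forall u, I u -> f u = g u) -> I t -> is_dpar s f t d -> is_dpar s g t d.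
Proof.
  intros Hfg Ht. apply is_derive_ext_loc.
  apply filter_imp with I; [exact Hfg|now apply HI].
Qed.

Lemma dpar_ext f g t : (forall u, I u -> f u = g u) -> I t -> dpar s f t = dpar s g t.
Proof.
  intros Hfg Ht. unfold dpar. f_equal. apply Derive_ext_loc.
  apply filter_imp with I; [exact Hfg|now apply HI].
Qed.

Lemma diter_ext j f g t : (forall u, I u -> f u = g u) -> I t -> diter s j f t = diter s j g t.
Proof.
  intros Hfg. revert t. induction j as [|j IH]; [exact Hfg|].
  intros t Ht. now apply dpar_ext.
Qed.

(** The induction step for computing the successive derivatives of a function. *)
Lemma diter_S f j g t d :
  (forall u, I u -> diter s j f u = g u) -> I t -> is_dpar s g t d -> diter s (S j) f t = d.
Proof.
  intros Hj Ht Hg. simpl. rewrite (dpar_ext _ g t Hj Ht). now apply dpar_unique.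
Qed.

Lemma viter_S x j g t d :
  (forall u, I u -> viter s j x u = g u) -> I t -> is_vdpar s g t d -> viter s (S j) x t = d.
Proof.
  intros Hj Ht (H1 & H2 & H3). apply V3_eq.
  - apply (diter_S _ j (fun u => coord1 (g u))); auto.
    intros u Hu; now rewrite <- Hj.
  - apply (diter_S _ j (fun u => coord2 (g u))); auto.
    intros u Hu; now rewrite <- Hj.
  - apply (diter_S _ j (fun u => coord3 (g u))); auto.
    intros u Hu; now rewrite <- Hj.
Qed.

Lemma viter_ext j x y t : (forall u, I u -> x u = y u) -> I t -> viter s j x t = viter s j y t.
Proof.
  intros Hxy Ht.
  apply V3_eq; apply diter_ext; auto; intros u Hu; now rewrite Hxy.
Qed.

Lemma vsmooth_viter j x : vsmooth_on I x -> vsmooth_on I (viter s j x).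
Proof.
  intros (H1 & H2 & H3). split; [|split];
    [change (smooth_on I (diter s j (fun t => coord1 (x t))))
    |change (smooth_on I (diter s j (fun t => coord2 (x t))))
    |change (smooth_on I (diter s j (fun t => coord3 (x t))))]; now apply smooth_diter.
Qed.

Lemma is_vdpar_viter j x t :
  vsmooth_on I x -> I t -> is_vdpar s (viter s j x) t (viter s (S j) x t).
Proof.
  intros Hx Ht. destruct (vsmooth_viter j x Hx) as (H1 & H2 & H3).
  split; [|split]; now apply smooth_is_dpar.
Qed.

(** ** Derivatives of a curve in a moving frame *)

Section MovingFrame.
Context (x e1 e2 e3 : R -> V3) (d1 d2 d3 : R -> V3).
Context (H1 : forall t, I t -> is_vdpar s e1 t (lin_comb (e1 t) (e2 t) (e3 t) (d1 t))).
Context (H2 : forall t, I t -> is_vdpar s e2 t (lin_comb (e1 t) (e2 t) (e3 t) (d2 t))).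
Context (H3 : forall t, I t -> is_vdpar s e3 t (lin_comb (e1 t) (e2 t) (e3 t) (d3 t))).

(** The coordinates of the derivative are those of the covariant derivative of
    [(a, b, c)], for the connection with coefficients [d1, d2, d3]. *)
Lemma viter_frame_S j (a b c : R -> R) t da db dc v :
  (forall u, I u -> viter s j x u = lin_comb (e1 u) (e2 u) (e3 u) (vec (a u) (b u) (c u))) ->
  I t -> is_dpar s a t da -> is_dpar s b t db -> is_dpar s c t dc ->
  plus (vec da db dc) (lin_comb (d1 t) (d2 t) (d3 t) (vec (a t) (b t) (c t))) = v ->
  viter s (S j) x t = lin_comb (e1 t) (e2 t) (e3 t) v.
Proof.
  intros Hj Ht Ha Hb Hc <-.
  apply (viter_S x j
    (fun u => plus (plus (scal (a u) (e1 u)) (scal (b u) (e2 u))) (scal (c u) (e3 u)))); auto.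
  eapply is_vdpar_eq.
  - apply is_vdpar_plus; [apply is_vdpar_plus|]; apply is_vdpar_scal; eauto.
  - vec_field.
Qed.
End MovingFrame.

Section AffineFrameJets.
Context (W l m : R -> R) (HW : smooth_on I W) (Hl : smooth_on I l) (Hm : smooth_on I m).
Context (x e1 e2 e3 : R -> V3).
Context (Hx : forall t, I t -> is_vdpar s x t (scal (W t) (e1 t))).
Context (H1 : forall t, I t -> is_vdpar s e1 t (scal (W t) (e2 t))).
Context (H2 : forall t, I t -> is_vdpar s e2 t (scal (W t) (e3 t))).

Let W1 := dpar s W.
Let W2 := dpar s W1.
Let W3 := dpar s W2.
Let W4 := dpar s W3.
Let m1 := dpar s m.
Let l1 := dpar s l.
Let HW1 : smooth_on I W1 := smooth_dpar _ HW.
Let HW2 : smooth_on I W2 := smooth_dpar _ HW1.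
Let HW3 : smooth_on I W3 := smooth_dpar _ HW2.
Let DW t (Ht : I t) : is_dpar s W t (W1 t) := smooth_is_dpar W t HW Ht.
Let DW1 t (Ht : I t) : is_dpar s W1 t (W2 t) := smooth_is_dpar W1 t HW1 Ht.
Let DW2 t (Ht : I t) : is_dpar s W2 t (W3 t) := smooth_is_dpar W2 t HW2 Ht.
Let DW3 t (Ht : I t) : is_dpar s W3 t (W4 t) := smooth_is_dpar W3 t HW3 Ht.
Let Dm t (Ht : I t) : is_dpar s m t (m1 t) := smooth_is_dpar m t Hm Ht.
Let Dl t (Ht : I t) : is_dpar s l t (l1 t) := smooth_is_dpar l t Hl Ht.

Lemma frame_jet1 t : I t -> viter s 1 x t = scal (W t) (e1 t).
Proof.
  intros Ht. apply (viter_S x 0 x); auto.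
  intros u Hu. now apply V3_eq.
Qed.

Lemma frame_jet2 t : I t ->
  viter s 2 x t = plus (scal (W1 t) (e1 t)) (scal (W t * W t) (e2 t)).
Proof.
  intros Ht. eapply viter_S; [exact frame_jet1|auto|].
  eapply is_vdpar_eq; [apply is_vdpar_scal; eauto|vec_field].
Qed.

Lemma frame_jet3 t : I t ->
  viter s 3 x t =
    lin_comb (e1 t) (e2 t) (e3 t) (vec (W2 t) (3 * W t * W1 t) (W t * W t * W t)).
Proof.
  intros Ht. eapply viter_S; [exact frame_jet2|auto|].
  assert (DWW : is_dpar s (fun u => W u * W u) t (2 * (W t * W1 t)))
    by (assert (D := DW t Ht); dpar_by ltac:(ring)).
  eapply is_vdpar_eq; [apply is_vdpar_plus; apply is_vdpar_scal; eauto|vec_field].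
Qed.

Context (H3 : forall t, I t ->
  is_vdpar s e3 t (scal (W t) (plus (scal (- m t) (e1 t)) (scal (- l t) (e2 t))))).

Let S1 t (Ht : I t) : is_vdpar s e1 t (lin_comb (e1 t) (e2 t) (e3 t) (vec 0 (W t) 0)).
Proof. eapply is_vdpar_eq; [now apply H1|vec_field]. Qed.

Let S2 t (Ht : I t) : is_vdpar s e2 t (lin_comb (e1 t) (e2 t) (e3 t) (vec 0 0 (W t))).
Proof. eapply is_vdpar_eq; [now apply H2|vec_field]. Qed.

Let S3 t (Ht : I t) :
  is_vdpar s e3 t (lin_comb (e1 t) (e2 t) (e3 t) (vec (- m t * W t) (- l t * W t) 0)).
Proof. eapply is_vdpar_eq; [now apply H3|vec_field]. Qed.

Lemma frame_jet4 t : I t ->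
  viter s 4 x t = lin_comb (e1 t) (e2 t) (e3 t)
    (vec (W3 t - m t * (W t * W t * W t * W t))
         (3 * W1 t * W1 t + 4 * W t * W2 t - l t * (W t * W t * W t * W t))
         (6 * W t * W t * W1 t)).
Proof.
  intros Ht. assert (D := DW t Ht). assert (D1 := DW1 t Ht). assert (D2 := DW2 t Ht).
  eapply (viter_frame_S x e1 e2 e3); [exact S1|exact S2|exact S3|exact frame_jet3|auto|dpar|dpar|dpar|].
  vec_field.
Qed.

(** Only the component along [e3] of the fifth derivative matters for the curvature. *)
Lemma frame_jet5 t : I t -> exists a b,
  viter s 5 x t = lin_comb (e1 t) (e2 t) (e3 t)
    (vec a b (15 * W t * W1 t * W1 t + 10 * W t * W t * W2 t - l t * (W t * W t * W t * W t * W t))).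
Proof.
  intros Ht. assert (D := DW t Ht). assert (D1 := DW1 t Ht). assert (D2 := DW2 t Ht).
  assert (D3 := DW3 t Ht). assert (D4 := Dm t Ht). assert (D5 := Dl t Ht).
  do 2 eexists.
  eapply (viter_frame_S x e1 e2 e3); [exact S1|exact S2|exact S3|exact frame_jet4|auto|dpar|dpar|dpar|].
  apply V3_eq; coord; [reflexivity|reflexivity|ring].
Qed.
End AffineFrameJets.

End Reparametrization.

(** * The affine curvature of a nondegenerate curve *)

(** A rational function of the first five derivatives that is unchanged when all of them
    are transformed by the same linear map, and that equals [l (omega/ds)^2] on every
    curve with an affine frame. *)
Definition rel_curv (x1 x2 x3 x4 x5 : V3) : R :=
  5 / 3 * (det x1 x3 x4 / det x1 x2 x3) + 2 / 3 * (det x1 x2 x5 / det x1 x2 x3)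
  - 35 / 36 * ((det x1 x2 x4 / det x1 x2 x3) * (det x1 x2 x4 / det x1 x2 x3)).

Definition curve_curv (s : R -> R) (x : R -> V3) (t : R) : R :=
  rel_curv (viter s 1 x t) (viter s 2 x t) (viter s 3 x t) (viter s 4 x t) (viter s 5 x t).

Definition curve_det (s : R -> R) (x : R -> V3) (t : R) : R :=
  det (viter s 1 x t) (viter s 2 x t) (viter s 3 x t).

Lemma rel_curv_lin_comb u v w x1 x2 x3 x4 x5 :
  det u v w <> 0 -> det x1 x2 x3 <> 0 ->
  rel_curv (lin_comb u v w x1) (lin_comb u v w x2) (lin_comb u v w x3)
    (lin_comb u v w x4) (lin_comb u v w x5) = rel_curv x1 x2 x3 x4 x5.
Proof.
  intros H1 H2. unfold rel_curv. rewrite !det_lin_comb. now field.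
Qed.

Lemma interval_open (a b : Rbar) : open (interval a b).
Proof.
  apply (open_and (fun t : R => Rbar_lt a t) (fun t : R => Rbar_lt t b)).
  - apply open_Rbar_gt.
  - apply open_Rbar_lt.
Qed.

Lemma interval_nonempty (a b : Rbar) : Rbar_lt a b -> exists t, interval a b t.
Proof.
  unfold interval. destruct a as [a| |], b as [b| |]; cbn; intros H; try contradiction.
  - exists ((a + b) / 2). lra.
  - exists (a + 1). split; [lra|trivial].
  - exists (b - 1). split; [trivial|lra].
  - now exists 0.
Qed.

Section Frames.
Context (I : R -> Prop) (s : R -> R).
Context (HI : open I) (Hs : smooth_on I (Derive s)) (Hs0 : forall t, I t -> 0 < Derive s t).

Lemma frame_det_ne0 x e1 e2 e3 w l m t :
  affine_frame I x e1 e2 e3 w l m -> I t -> det (e1 t) (e2 t) (e3 t) <> 0.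
Proof. intros F Ht. now apply lin_indep_det, (frame_indep _ _ _ _ _ _ _ _ F). Qed.

Lemma is_derive_is_vdpar y t r v :
  I t -> is_derive y t (scal r v) -> is_vdpar s y t (scal (r / Derive s t) v).
Proof.
  intros Ht H. apply is_derive_V3 in H.
  assert (E : forall a, Derive s t * (r / Derive s t * a) = r * a)
    by (intros a; field; specialize (Hs0 t Ht); lra).
  destruct H as (H1 & H2 & H3). unfold is_vdpar, is_dpar.
  change (coord1 (scal ?a v)) with (a * coord1 v) in *.
  change (coord2 (scal ?a v)) with (a * coord2 v) in *.
  change (coord3 (scal ?a v)) with (a * coord3 v) in *.
  rewrite !E. auto.
Qed.

Lemma frame_dpar x e1 e2 e3 w l m t :
  affine_frame I x e1 e2 e3 w l m -> I t ->
  let W := w t / Derive s t in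
  is_vdpar s x t (scal W (e1 t)) /\ is_vdpar s e1 t (scal W (e2 t)) /\
  is_vdpar s e2 t (scal W (e3 t)) /\
  is_vdpar s e3 t (scal W (plus (scal (- m t) (e1 t)) (scal (- l t) (e2 t)))).
Proof.
  intros F Ht. cbv zeta. split; [|split; [|split]]; apply is_derive_is_vdpar; auto.
  - apply (frame_dx _ _ _ _ _ _ _ _ F t Ht).
  - apply (frame_de1 _ _ _ _ _ _ _ _ F t Ht).
  - apply (frame_de2 _ _ _ _ _ _ _ _ F t Ht).
  - rewrite @scal_distr_l, !@scal_assoc.
    replace (mult (w t) (- m t)) with (- m t * w t) by apply Rmult_comm.
    replace (mult (w t) (- l t)) with (- l t * w t) by apply Rmult_comm.
    apply (frame_de3 _ _ _ _ _ _ _ _ F t Ht).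
Qed.

(** The first three derivatives are triangular in the frame, with diagonal [W, W^2, W^3]. *)
Lemma curve_det_frame x e1 e2 e3 W t :
  smooth_on I W ->
  (forall t, I t -> is_vdpar s x t (scal (W t) (e1 t))) ->
  (forall t, I t -> is_vdpar s e1 t (scal (W t) (e2 t))) ->
  (forall t, I t -> is_vdpar s e2 t (scal (W t) (e3 t))) ->
  I t -> curve_det s x t = W t ^ 6 * det (e1 t) (e2 t) (e3 t).
Proof.
  intros SW Hx H1 H2 Ht. unfold curve_det.
  rewrite (frame_jet1 I s HI Hs0 W x e1 Hx t Ht), (frame_jet2 I s HI Hs0 W SW x e1 e2 Hx H1 t Ht),
    (frame_jet3 I s HI Hs Hs0 W SW x e1 e2 e3 Hx H1 H2 t Ht).
  unfold det; coord; ring.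
Qed.

(** With [W = omega/ds] and [V = W'/W], the three quotients of determinants are
    [15 V^2 - 4 W''/W + l W^2], [15 V^2 + 10 W''/W - l W^2] and [6 V]; the coefficients of
    [rel_curv] are chosen so that only [l W^2] survives. *)
Lemma frame_curv x e1 e2 e3 w l m t :
  affine_frame I x e1 e2 e3 w l m -> I t ->
  let W := w t / Derive s t in
  curve_det s x t = W ^ 6 * det (e1 t) (e2 t) (e3 t) /\
  curve_curv s x t = l t * (W * W).
Proof.
  intros F Ht. set (W := fun t => w t / Derive s t). change (w t / Derive s t) with (W t).
  cbv zeta.
  assert (SW : smooth_on I W).
  { apply smooth_div; auto.
    - intros u Hu; specialize (Hs0 u Hu); lra.
    - apply (frame_smooth_w _ _ _ _ _ _ _ _ F). }
  assert (HW : 0 < W t).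
  { apply Rdiv_lt_0_compat; auto. apply (frame_w_pos _ _ _ _ _ _ _ _ F t Ht). }
  assert (Hx := fun t Ht => proj1 (frame_dpar _ _ _ _ _ _ _ t F Ht)).
  assert (H1 := fun t Ht => proj1 (proj2 (frame_dpar _ _ _ _ _ _ _ t F Ht))).
  assert (H2 := fun t Ht => proj1 (proj2 (proj2 (frame_dpar _ _ _ _ _ _ _ t F Ht)))).
  assert (H3 := fun t Ht => proj2 (proj2 (proj2 (frame_dpar _ _ _ _ _ _ _ t F Ht)))).
  assert (HD := curve_det_frame x e1 e2 e3 W t SW Hx H1 H2 Ht).
  split; auto.
  assert (Hd := frame_det_ne0 _ _ _ _ _ _ _ _ F Ht).
  assert (J4 := frame_jet4 I s HI Hs Hs0 W l m SW x e1 e2 e3 Hx H1 H2 H3 t Ht).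
  destruct (frame_jet5 I s HI Hs Hs0 W l m SW (frame_smooth_l _ _ _ _ _ _ _ _ F)
    (frame_smooth_m _ _ _ _ _ _ _ _ F) x e1 e2 e3 Hx H1 H2 H3 t Ht) as (a5 & b5 & J5).
  unfold curve_curv.
  rewrite (frame_jet1 I s HI Hs0 W x e1 Hx t Ht), (frame_jet2 I s HI Hs0 W SW x e1 e2 Hx H1 t Ht),
    (frame_jet3 I s HI Hs Hs0 W SW x e1 e2 e3 Hx H1 H2 t Ht), J4, J5.
  replace (scal (W t) (e1 t)) with (lin_comb (e1 t) (e2 t) (e3 t) (vec (W t) 0 0)) by vec_field.
  replace (plus _ _) with (lin_comb (e1 t) (e2 t) (e3 t) (vec (dpar s W t) (W t * W t) 0)) by vec_field.
  rewrite rel_curv_lin_comb; auto.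
  - unfold rel_curv, det; coord. field. lra.
  - unfold det; coord. replace (_ - _ + _) with (W t ^ 6) by ring. apply pow_nonzero; lra.
Qed.

Lemma length_coef_curv x e1 e2 e3 w l m t :
  affine_frame I x e1 e2 e3 w l m -> I t -> l t <> 0 ->
  length_coef w l t =
    Derive s t * Rpower (curve_curv s x t * curve_curv s x t) (1 / 4).
Proof.
  intros F Ht Hl. destruct (frame_curv _ _ _ _ _ _ _ _ F Ht) as [_ ->].
  assert (Hw := frame_w_pos _ _ _ _ _ _ _ _ F t Ht). assert (Hp := Hs0 t Ht).
  assert (HW : 0 < w t / Derive s t) by now apply Rdiv_lt_0_compat.
  set (W := w t / Derive s t) in *.
  assert (Hsl : 0 < sign (l t) * l t).
  { destruct (Rlt_or_le 0 (l t)).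
    - rewrite sign_eq_1; lra.
    - rewrite sign_eq_m1; lra. }
  assert (Hs2 : sign (l t) * sign (l t) = 1).
  { destruct (Rlt_or_le 0 (l t)); [rewrite sign_eq_1|rewrite sign_eq_m1]; lra. }
  set (q := sqrt (sign (l t) * l t)).
  assert (Hq : 0 < q) by now apply sqrt_lt_R0.
  assert (Hqq : q * q = sign (l t) * l t) by (apply sqrt_sqrt; lra).
  replace (l t * (W * W) * (l t * (W * W))) with (Rpower (q * W) (INR 4)).
  - rewrite Rpower_mult. replace (INR 4 * (1 / 4)) with 1 by (simpl; lra).
    rewrite Rpower_1 by now apply Rmult_lt_0_compat.
    unfold length_coef, W. fold q. field. lra.
  - rewrite Rpower_pow by now apply Rmult_lt_0_compat.
    replace ((q * W) ^ 4) with ((q * q) * (q * q) * W ^ 4) by ring. rewrite Hqq.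
    transitivity ((sign (l t) * sign (l t)) * (l t * l t) * W ^ 4); [ring|].
    rewrite Hs2; ring.
Qed.

Lemma smooth_det u v w :
  vsmooth_on I u -> vsmooth_on I v -> vsmooth_on I w ->
  smooth_on I (fun t => det (u t) (v t) (w t)).
Proof.
  intros (U1 & U2 & U3) (V1 & V2 & V3) (W1 & W2 & W3). unfold det.
  smooth.
Qed.

Lemma smooth_curve_det x : vsmooth_on I x -> smooth_on I (curve_det s x).
Proof. intros Hx. apply (smooth_det (viter s 1 x) (viter s 2 x) (viter s 3 x)); now apply vsmooth_viter. Qed.

(** A curve with independent first three derivatives has a frame: normalizing
    [det (e1, e2, e3)] to be [1] or [-1] determines [omega], and then [de3] has no
    [e3] component because the determinant is constant. *)
Lemma frame_exists x :
  vsmooth_on I x -> (forall t, I t -> curve_det s x t <> 0) ->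
  exists e1 e2 e3 w l m, affine_frame I x e1 e2 e3 w l m.
Proof.
  intros Hx HP. set (P := curve_det s x) in *.
  assert (SP : smooth_on I P) by now apply smooth_curve_det.
  assert (HPP : forall t, I t -> 0 < P t * P t) by (intros t Ht; specialize (HP t Ht); nra).
  pose (W := fun t => Rpower (P t * P t) (1 / 12)).
  assert (SW : smooth_on I W) by (apply smooth_pow; auto; now apply smooth_mult).
  assert (HW : forall t, I t -> 0 < W t) by (intros; apply exp_pos).
  assert (HWn : forall t, I t -> W t <> 0) by (intros t Ht; specialize (HW t Ht); lra).
  assert (HW12 : forall t, I t -> W t ^ 12 = P t * P t).
  { intros t Ht. rewrite <- Rpower_pow by now apply HW. unfold W.
    rewrite Rpower_mult. replace (1 / 12 * INR 12) with 1 by (simpl; lra).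
    now rewrite Rpower_1 by now apply HPP. }
  pose (next := fun y t => scal (/ W t) (viter s 1 y t)).
  assert (Snext : forall y, vsmooth_on I y -> vsmooth_on I (next y)).
  { intros y Sy. destruct (vsmooth_viter I s HI Hs Hs0 1 y Sy) as (Y1 & Y2 & Y3).
    assert (SV : smooth_on I (fun t => / W t)).
    { apply (smooth_ext I HI (fun t => 1 / W t)); [intros; unfold Rdiv; ring|].
      apply smooth_div; auto. now apply smooth_const. }
    split; [|split].
    - exact (smooth_mult I HI _ _ SV Y1).
    - exact (smooth_mult I HI _ _ SV Y2).
    - exact (smooth_mult I HI _ _ SV Y3). }
  assert (DD : forall y, vsmooth_on I y -> forall t, I t -> is_vdpar s y t (scal (W t) (next y t))).
  { intros y Sy t Ht. eapply is_vdpar_eq.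
    - exact (is_vdpar_viter I s HI Hs Hs0 0 y t Sy Ht).
    - unfold next. apply V3_eq; coord; field; auto. }
  assert (DV : forall y, vsmooth_on I y -> forall t, I t ->
     is_derive y t (scal (W t * Derive s t) (next y t))).
  { intros y Sy t Ht. destruct (DD y Sy t Ht) as (Y1 & Y2 & Y3). unfold is_dpar in *.
    apply is_derive_V3. revert Y1 Y2 Y3. coord.
    rewrite <- !Rmult_assoc, (Rmult_comm (Derive s t)). auto. }
  set (e1 := next x). set (e2 := next e1). set (e3 := next e2). set (f := next e3).
  assert (S1 : vsmooth_on I e1) by now apply Snext.
  assert (S2 : vsmooth_on I e2) by now apply Snext.
  assert (S3 : vsmooth_on I e3) by now apply Snext.
  assert (Sf : vsmooth_on I f) by now apply Snext.
  pose (d := fun t => det (e1 t) (e2 t) (e3 t)).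
  assert (HPd : forall t, I t -> P t = W t ^ 6 * d t).
  { intros t Ht. exact (curve_det_frame x e1 e2 e3 W t SW (DD x Hx) (DD e1 S1) (DD e2 S2) Ht). }
  assert (Hdd : forall t, I t -> d t * d t = 1).
  { intros t Ht. assert (H := HPd t Ht). assert (H' := HW12 t Ht). rewrite H in H'.
    apply Rmult_eq_reg_l with (W t ^ 12); [|now apply pow_nonzero, HWn].
    rewrite Rmult_1_r. rewrite H' at 2. ring. }
  assert (Hd0 : forall t, I t -> d t <> 0) by (intros t Ht E; specialize (Hdd t Ht); rewrite E in Hdd; lra).
  assert (Hf : forall t, I t -> det (e1 t) (e2 t) (f t) = 0).
  { intros t Ht.
    assert (Dd : is_dpar s d t (W t * det (e1 t) (e2 t) (f t))).
    { eapply is_dpar_eq.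
      - exact (is_dpar_det s e1 e2 e3 t _ _ _ (DD e1 S1 t Ht) (DD e2 S2 t Ht) (DD e3 S3 t Ht)).
      - fold e2 e3 f. unfold det; coord. ring. }
    assert (Ddd : is_dpar s (fun z => d z * d z) t 0).
    { apply (is_dpar_ext I s HI (fun _ => 1)); auto.
      - intros; symmetry; auto.
      - apply is_dpar_const. }
    assert (E := dpar_unique I s Hs0 _ _ _ Ht Ddd).
    rewrite (dpar_unique I s Hs0 _ _ _ Ht (is_dpar_mult _ _ _ _ _ _ Dd Dd)) in E.
    assert (E' : (W t * d t) * det (e1 t) (e2 t) (f t) = 0) by lra.
    apply Rmult_integral in E'. destruct E' as [E'|]; auto.
    apply Rmult_integral in E'. destruct E' as [E'|E'].
    - now apply HWn in E'.
    - now apply Hd0 in E'. }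
  exists e1, e2, e3, (fun t => W t * Derive s t),
    (fun t => - coord2 (coords (e1 t) (e2 t) (e3 t) (f t))),
    (fun t => - coord1 (coords (e1 t) (e2 t) (e3 t) (f t))).
  split; auto.
  - now apply smooth_mult.
  - apply smooth_opp; auto. apply smooth_div; auto; now apply smooth_det.
  - apply smooth_opp; auto. apply smooth_div; auto; now apply smooth_det.
  - intros t Ht. apply lin_indep_det. now apply Hd0.
  - intros t Ht. exact (Rmult_lt_0_compat _ _ (HW t Ht) (Hs0 t Ht)).
  - intros t Ht. assert (H := DV e3 S3 t Ht).
    replace (plus _ _) with (scal (W t * Derive s t) (next e3 t)); [exact H|].
    fold f. rewrite <- (lin_comb_coords (e1 t) (e2 t) (e3 t) (f t)) at 1 by now apply Hd0.
    assert (C3 : coord3 (coords (e1 t) (e2 t) (e3 t) (f t)) = 0).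
    { unfold coords, vec; cbn [coord1 coord2 coord3 fst snd]. rewrite Hf by auto.
      unfold Rdiv. now rewrite Rmult_0_l. }
    set (c := coords _ _ _ _) in *.
    apply V3_eq; coord; rewrite C3; ring.
Qed.
End Frames.

(** * The first variation of the affine curvature *)

Definition var_det (x y z dx dy dz : V3) : R := det dx y z + det x dy z + det x y dz.

Definition var_quot (a b da db : R) : R := (da * b - a * db) / (b * b).

(** The differential of [rel_curv] at [(x1, .., x5)] in the direction [(y1, .., y5)]. *)
Definition var_rel_curv (x1 x2 x3 x4 x5 y1 y2 y3 y4 y5 : V3) : R :=
  let P := det x1 x2 x3 in let dP := var_det x1 x2 x3 y1 y2 y3 in
  5 / 3 * var_quot (det x1 x3 x4) P (var_det x1 x3 x4 y1 y3 y4) dP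
  + 2 / 3 * var_quot (det x1 x2 x5) P (var_det x1 x2 x5 y1 y2 y5) dP
  - 35 / 18 * (det x1 x2 x4 / P) * var_quot (det x1 x2 x4) P (var_det x1 x2 x4 y1 y2 y4) dP.

Lemma is_dpar_rel_curv s (x1 x2 x3 x4 x5 : R -> V3) t y1 y2 y3 y4 y5 :
  det (x1 t) (x2 t) (x3 t) <> 0 ->
  is_vdpar s x1 t y1 -> is_vdpar s x2 t y2 -> is_vdpar s x3 t y3 ->
  is_vdpar s x4 t y4 -> is_vdpar s x5 t y5 ->
  is_dpar s (fun z => rel_curv (x1 z) (x2 z) (x3 z) (x4 z) (x5 z)) t
    (var_rel_curv (x1 t) (x2 t) (x3 t) (x4 t) (x5 t) y1 y2 y3 y4 y5).
Proof.
  intros HP H1 H2 H3 H4 H5.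
  assert (DP := is_dpar_det _ _ _ _ _ _ _ _ H1 H2 H3).
  assert (DQ := is_dpar_div _ _ _ _ _ _ HP (is_dpar_det _ _ _ _ _ _ _ _ H1 H3 H4) DP).
  assert (DR := is_dpar_div _ _ _ _ _ _ HP (is_dpar_det _ _ _ _ _ _ _ _ H1 H2 H4) DP).
  assert (DS := is_dpar_div _ _ _ _ _ _ HP (is_dpar_det _ _ _ _ _ _ _ _ H1 H2 H5) DP).
  unfold rel_curv.
  dpar_by ltac:(unfold var_rel_curv, var_quot, var_det; cbv zeta; field; exact HP).
Qed.

Lemma var_rel_curv_lin_comb u v w x1 x2 x3 x4 x5 y1 y2 y3 y4 y5 :
  det u v w <> 0 -> det x1 x2 x3 <> 0 ->
  var_rel_curv (lin_comb u v w x1) (lin_comb u v w x2) (lin_comb u v w x3)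
    (lin_comb u v w x4) (lin_comb u v w x5)
    (lin_comb u v w y1) (lin_comb u v w y2) (lin_comb u v w y3)
    (lin_comb u v w y4) (lin_comb u v w y5)
  = var_rel_curv x1 x2 x3 x4 x5 y1 y2 y3 y4 y5.
Proof.
  intros H1 H2. unfold var_rel_curv, var_quot, var_det; cbv zeta.
  rewrite !det_lin_comb. field. split; auto.
Qed.

(** The structure equations of the homothety-invariant frame with respect to the
    general-affine length parameter. *)
Record general_affine_frame (I : R -> Prop) (s k M : R -> R) (eps : R)
    (x E1 E2 E3 : R -> V3) : Prop := {
  gaf_open : open I;
  gaf_smooth_s : smooth_on I (Derive s);
  gaf_s_pos : forall t, I t -> 0 < Derive s t;
  gaf_smooth_k : smooth_on I k;
  gaf_smooth_M : smooth_on I M;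
  gaf_smooth_E1 : vsmooth_on I E1;
  gaf_smooth_E2 : vsmooth_on I E2;
  gaf_smooth_E3 : vsmooth_on I E3;
  gaf_eps : eps * eps = 1;
  gaf_indep : forall t, I t -> det (E1 t) (E2 t) (E3 t) <> 0;
  gaf_dx : forall t, I t -> is_vdpar s x t (E1 t);
  gaf_dE1 : forall t, I t ->
    is_vdpar s E1 t (lin_comb (E1 t) (E2 t) (E3 t) (vec (- (1 / 2) * k t) 1 0));
  gaf_dE2 : forall t, I t ->
    is_vdpar s E2 t (lin_comb (E1 t) (E2 t) (E3 t) (vec 0 (- k t) 1));
  gaf_dE3 : forall t, I t ->
    is_vdpar s E3 t (lin_comb (E1 t) (E2 t) (E3 t) (vec (- M t) (- eps) (- (3 / 2) * k t)))
}.

Section GeneralAffineFrame.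
Context (I : R -> Prop) (s k M : R -> R) (eps : R) (x E1 E2 E3 : R -> V3).
Context (F : general_affine_frame I s k M eps x E1 E2 E3).

Let HI := gaf_open _ _ _ _ _ _ _ _ _ F.
Let Hs := gaf_smooth_s _ _ _ _ _ _ _ _ _ F.
Let Hs0 := gaf_s_pos _ _ _ _ _ _ _ _ _ F.
Let Hk := gaf_smooth_k _ _ _ _ _ _ _ _ _ F.
Let HM := gaf_smooth_M _ _ _ _ _ _ _ _ _ F.
Let Heps := gaf_eps _ _ _ _ _ _ _ _ _ F.
Let HE := gaf_indep _ _ _ _ _ _ _ _ _ F.
Let Hx := gaf_dx _ _ _ _ _ _ _ _ _ F.
Let HE1 := gaf_dE1 _ _ _ _ _ _ _ _ _ F.
Let HE2 := gaf_dE2 _ _ _ _ _ _ _ _ _ F.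
Let HE3 := gaf_dE3 _ _ _ _ _ _ _ _ _ F.

Let k1 := dpar s k.
Let k2 := dpar s k1.
Let k3 := dpar s k2.
Let k4 := dpar s k3.
Let M1 := dpar s M.
Let M2 := dpar s M1.
Let Hk1 : smooth_on I k1 := smooth_dpar I s HI Hs Hs0 _ Hk.
Let Hk2 : smooth_on I k2 := smooth_dpar I s HI Hs Hs0 _ Hk1.
Let Hk3 : smooth_on I k3 := smooth_dpar I s HI Hs Hs0 _ Hk2.
Let HM1 : smooth_on I M1 := smooth_dpar I s HI Hs Hs0 _ HM.
Let Dk t (Ht : I t) : is_dpar s k t (k1 t) := smooth_is_dpar I s Hs0 _ t Hk Ht.
Let Dk1 t (Ht : I t) : is_dpar s k1 t (k2 t) := smooth_is_dpar I s Hs0 _ t Hk1 Ht.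
Let Dk2 t (Ht : I t) : is_dpar s k2 t (k3 t) := smooth_is_dpar I s Hs0 _ t Hk2 Ht.
Let Dk3 t (Ht : I t) : is_dpar s k3 t (k4 t) := smooth_is_dpar I s Hs0 _ t Hk3 Ht.
Let DM t (Ht : I t) : is_dpar s M t (M1 t) := smooth_is_dpar I s Hs0 _ t HM Ht.
Let DM1 t (Ht : I t) : is_dpar s M1 t (M2 t) := smooth_is_dpar I s Hs0 _ t HM1 Ht.

(** Coordinates of the derivatives of [x] in the frame [E1, E2, E3]; each is the covariant
    derivative of the previous one. *)
Definition jet1 : V3 := vec 1 0 0.
Definition jet2 (k : R) : V3 := vec (- (1 / 2) * k) 1 0.
Definition jet3 (k k1 : R) : V3 := vec (1 / 4 * k * k - 1 / 2 * k1) (- (3 / 2) * k) 1.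
Definition jet4 (eps k k1 k2 M : R) : V3 :=
  vec (3 / 4 * k * k1 - 1 / 8 * k * k * k - 1 / 2 * k2 - M) (7 / 4 * k * k - 2 * k1 - eps) (- (3) * k).
Definition jet5 (eps k k1 k2 k3 M M1 : R) : V3 :=
  vec (7 / 2 * M * k - M1 + k * k2 - 3 / 4 * k * k * k1 + 1 / 16 * k * k * k * k + 3 / 4 * k1 * k1 - 1 / 2 * k3)
      (4 * eps * k - M + 25 / 4 * k * k1 - 15 / 8 * k * k * k - 5 / 2 * k2)
      (25 / 4 * k * k - 5 * k1 - eps).

Lemma base_viter t : I t ->
  viter s 1 x t = lin_comb (E1 t) (E2 t) (E3 t) jet1 /\
  viter s 2 x t = lin_comb (E1 t) (E2 t) (E3 t) (jet2 (k t)) /\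
  viter s 3 x t = lin_comb (E1 t) (E2 t) (E3 t) (jet3 (k t) (k1 t)) /\
  viter s 4 x t = lin_comb (E1 t) (E2 t) (E3 t) (jet4 eps (k t) (k1 t) (k2 t) (M t)) /\
  viter s 5 x t = lin_comb (E1 t) (E2 t) (E3 t) (jet5 eps (k t) (k1 t) (k2 t) (k3 t) (M t) (M1 t)).
Proof.
  assert (J := viter_frame_S I s HI Hs0 x E1 E2 E3 _ _ _ HE1 HE2 HE3).
  assert (J1 : forall u, I u -> viter s 1 x u = lin_comb (E1 u) (E2 u) (E3 u) (vec 1 0 0)).
  { intros u Hu. apply (viter_S I s HI Hs0 x 0 x u); auto.
    - intros v Hv. now apply V3_eq.
    - eapply is_vdpar_eq; [now apply Hx|vec_field]. }
  assert (J2 : forall u, I u -> viter s 2 x u = lin_comb (E1 u) (E2 u) (E3 u) (jet2 (k u))).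
  { intros u Hu.
    apply (J 1%nat (fun _ => 1) (fun _ => 0) (fun _ => 0) u 0 0 0); auto using is_dpar_const.
    unfold jet2; vec_field. }
  assert (J3 : forall u, I u -> viter s 3 x u = lin_comb (E1 u) (E2 u) (E3 u) (jet3 (k u) (k1 u))).
  { intros u Hu. eapply J; [exact J2|auto|dpar|dpar|dpar|]. unfold jet3; vec_field. }
  assert (J4 : forall u, I u -> viter s 4 x u =
      lin_comb (E1 u) (E2 u) (E3 u) (jet4 eps (k u) (k1 u) (k2 u) (M u))).
  { intros u Hu. eapply J; [exact J3|auto|dpar|dpar|dpar|]. unfold jet4; vec_field. }
  intros Ht. split; [|split; [|split; [|split]]]; auto.
  eapply J; [exact J4|auto|dpar|dpar|dpar|]. unfold jet5; vec_field.
Qed.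

(** The length parameter makes [l (omega/ds)^2 = eps]. *)
Lemma base_curv t : I t ->
  curve_det s x t = det (E1 t) (E2 t) (E3 t) /\ curve_curv s x t = eps.
Proof.
  intros Ht. destruct (base_viter t Ht) as (J1 & J2 & J3 & J4 & J5).
  unfold curve_det, curve_curv. rewrite J1, J2, J3, J4, J5.
  assert (HD : det jet1 (jet2 (k t)) (jet3 (k t) (k1 t)) = 1)
    by (unfold det, jet1, jet2, jet3, vec; cbn [coord1 coord2 coord3 fst snd]; ring).
  split.
  - rewrite det_lin_comb, HD. ring.
  - rewrite rel_curv_lin_comb; auto; [|rewrite HD; lra].
    unfold rel_curv. rewrite HD.
    unfold det, jet1, jet2, jet3, jet4, jet5, vec; cbn [coord1 coord2 coord3 fst snd]. field.
Qed.

Section Field.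
Context (Y : R -> V3) (HY : vsmooth_on I Y).

(** Coordinates of the [j]-th derivative of the field [Y]. Working with these coordinates,
    instead of the derivatives of the coordinates of [Y], keeps all formulas linear and
    short: differentiating them only shifts [j], up to the connection terms. *)
Definition frame_coords (j : nat) (t : R) : V3 := coords (E1 t) (E2 t) (E3 t) (viter s j Y t).

Let u (j : nat) (t : R) := coord1 (frame_coords j t).
Let v (j : nat) (t : R) := coord2 (frame_coords j t).
Let w (j : nat) (t : R) := coord3 (frame_coords j t).

Lemma field_viter j t : I t -> viter s j Y t = lin_comb (E1 t) (E2 t) (E3 t) (frame_coords j t).
Proof. intros Ht. symmetry. apply lin_comb_coords. auto. Qed.

Lemma is_dpar_frame_coords j t : I t ->
  is_dpar s (u j) t (u (S j) t + 1 / 2 * k t * u j t + M t * w j t) /\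
  is_dpar s (v j) t (v (S j) t + k t * v j t - u j t + eps * w j t) /\
  is_dpar s (w j) t (w (S j) t + 3 / 2 * k t * w j t - v j t).
Proof.
  intros Ht.
  assert (DY := is_vdpar_viter I s HI Hs Hs0 j Y t HY Ht).
  assert (D1 := HE1 t Ht). assert (D2 := HE2 t Ht). assert (D3 := HE3 t Ht).
  assert (DD := is_dpar_det _ _ _ _ _ _ _ _ D1 D2 D3).
  assert (Hd := HE t Ht).
  assert (Fj := field_viter j t Ht). assert (FS := field_viter (S j) t Ht).
  set (c := frame_coords j t) in *. set (c' := frame_coords (S j) t) in *.
  set (d1 := vec _ 1 0) in D1, DD. set (d2 := vec _ _ 1) in D2, DD. set (d3 := vec _ _ (- (3 / 2) * k t)) in D3, DD.
  split; [|split].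
  - eapply is_dpar_eq; [exact (is_dpar_div _ _ _ _ _ _ Hd (is_dpar_det _ _ _ _ _ _ _ _ DY D2 D3) DD)|].
    cbv beta. rewrite FS, Fj.
    rewrite !(proj1 (det_lin_comb1 _ _ _ _)), !(proj1 (proj2 (det_lin_comb1 _ _ _ _))),
      !(proj2 (proj2 (det_lin_comb1 _ _ _ _))), !(proj1 (det_lin_comb2 _ _ _ _ _)),
      !(proj1 (proj2 (det_lin_comb2 _ _ _ _ _))).
    unfold u. fold c c'. unfold w. fold c.
    unfold d1, d2, d3, vec; cbn [coord1 coord2 coord3 fst snd]. now field.
  - eapply is_dpar_eq; [exact (is_dpar_div _ _ _ _ _ _ Hd (is_dpar_det _ _ _ _ _ _ _ _ D1 DY D3) DD)|].
    cbv beta. rewrite FS, Fj.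
    rewrite !(proj1 (det_lin_comb1 _ _ _ _)), !(proj1 (proj2 (det_lin_comb1 _ _ _ _))),
      !(proj2 (proj2 (det_lin_comb1 _ _ _ _))), !(proj1 (det_lin_comb2 _ _ _ _ _)),
      !(proj2 (proj2 (det_lin_comb2 _ _ _ _ _))).
    unfold v. fold c c'. unfold u, w. fold c.
    unfold d1, d2, d3, vec; cbn [coord1 coord2 coord3 fst snd]. now field.
  - eapply is_dpar_eq; [exact (is_dpar_div _ _ _ _ _ _ Hd (is_dpar_det _ _ _ _ _ _ _ _ D1 D2 DY) DD)|].
    cbv beta. rewrite FS, Fj.
    rewrite !(proj1 (det_lin_comb1 _ _ _ _)), !(proj1 (proj2 (det_lin_comb1 _ _ _ _))),
      !(proj2 (proj2 (det_lin_comb1 _ _ _ _))), !(proj1 (proj2 (det_lin_comb2 _ _ _ _ _))),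
      !(proj2 (proj2 (det_lin_comb2 _ _ _ _ _))).
    unfold w. fold c c'. unfold v. fold c.
    unfold d1, d2, d3, vec; cbn [coord1 coord2 coord3 fst snd]. now field.
Qed.

(** The Euler-Lagrange expressions for normal variations along [E2] and [E3]. *)
Definition EL2 (t : R) : R :=
  - (5 / 12) * eps * (k3 t + 3 / 2 * k t * k2 t + 1 / 2 * k1 t * k1 t + 1 / 2 * k t * k t * k1 t
     - 1 / 5 * eps * k1 t + 6 / 5 * M1 t).

Definition EL3 (t : R) : R :=
  eps * (- (1 / 4) * M t * k1 t + 3 / 4 * M1 t * k t + 1 / 2 * M2 t + 7 / 24 * k t * k1 t * k1 t
    + 1 / 2 * k t * k3 t + 11 / 24 * k t * k t * k2 t + 1 / 8 * k t * k t * k t * k1 t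
    + 5 / 12 * k1 t * k2 t + 1 / 6 * k4 t) - 1 / 4 * k t * k1 t - 1 / 3 * k2 t.

(** The terms collected while removing, from the highest order down, the derivatives of
    [Y] from [eps/2 dG(Y)] by parts. *)
Definition boundary (t : R) : R :=
  1 / 3 * eps * w 4 t
  - 1 / 2 * eps * v 3 t + 7 / 6 * eps * k t * w 3 t
  - 1 / 2 * eps * u 2 t - 5 / 6 * eps * k t * v 2 t
    + (5 / 6 + 7 / 6 * eps * k t * k t + 1 / 2 * eps * k1 t) * w 2 t
  - 7 / 12 * eps * k t * u 1 t - (7 / 24 * eps * k t * k t + 1 / 3 * eps * k1 t) * v 1 t
    + (5 / 6 * eps * M t + 2 / 3 * eps * k t * k1 t + 1 / 3 * eps * k t * k t * k t + 1 / 3 * eps * k2 t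
       + 5 / 12 * k t) * w 1 t
  + 1 / 4 * eps * k1 t * u 0 t + (1 / 8 * eps * k t * k1 t + 1 / 4 * eps * k2 t) * v 0 t
    + (1 / 12 * k1 t - 1 / 2 * eps * M1 t - 1 / 4 * eps * k t * k2 t - 1 / 12 * eps * k t * k t * k1 t
       - 1 / 12 * eps * k1 t * k1 t - 1 / 6 * eps * k3 t) * w 0 t.

(** Once the derivatives of the coordinates of [Y] are expressed by the coordinates of its
    derivatives, this is an identity between polynomials in [k], [M] and their derivatives,
    linear in [Y], modulo [eps^2 = 1]. *)
Lemma is_dpar_boundary t : I t ->
  is_dpar s boundary t
   (eps / 2 * var_rel_curv (viter s 1 x t) (viter s 2 x t) (viter s 3 x t) (viter s 4 x t) (viter s 5 x t)
      (viter s 1 Y t) (viter s 2 Y t) (viter s 3 Y t) (viter s 4 Y t) (viter s 5 Y t)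
    - (EL2 t * v 0 t + EL3 t * w 0 t)).
Proof.
  intros Ht.
  destruct (is_dpar_frame_coords 0 t Ht) as (U0 & V0 & W0).
  destruct (is_dpar_frame_coords 1 t Ht) as (U1 & V1 & W1).
  destruct (is_dpar_frame_coords 2 t Ht) as (U2 & V2 & W2).
  destruct (is_dpar_frame_coords 3 t Ht) as (U3 & V3 & W3).
  destruct (is_dpar_frame_coords 4 t Ht) as (U4 & V4 & W4).
  assert (A1 := Dk t Ht). assert (A2 := Dk1 t Ht). assert (A3 := Dk2 t Ht). assert (A4 := Dk3 t Ht).
  assert (A5 := DM t Ht). assert (A6 := DM1 t Ht).
  unfold boundary.
  eapply is_dpar_eq; [dpar|]. cbv beta.
  destruct (base_viter t Ht) as (J1 & J2 & J3 & J4 & J5).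
  rewrite J1, J2, J3, J4, J5, !field_viter by auto.
  assert (HD : det jet1 (jet2 (k t)) (jet3 (k t) (k1 t)) = 1)
    by (unfold det, jet1, jet2, jet3, vec; cbn [coord1 coord2 coord3 fst snd]; ring).
  rewrite var_rel_curv_lin_comb by (auto; rewrite HD; lra).
  unfold var_rel_curv, var_quot; cbv zeta. rewrite HD.
  unfold u, v, w.
  destruct (frame_coords 0 t) as [[u0 v0] w0].
  destruct (frame_coords 1 t) as [[u1 v1] w1].
  destruct (frame_coords 2 t) as [[u2 v2] w2].
  destruct (frame_coords 3 t) as [[u3 v3] w3].
  destruct (frame_coords 4 t) as [[u4 v4] w4].
  destruct (frame_coords 5 t) as [[u5 v5] w5].
  unfold EL2, EL3, var_det, det, jet1, jet2, jet3, jet4, jet5, vec; cbn [coord1 coord2 coord3 fst snd].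
  generalize (k t) (k1 t) (k2 t) (k3 t) (k4 t) (M t) (M1 t) (M2 t).
  clear - Heps. intros.
  field_simplify_eq. replace (eps ^ 2) with 1 by lra.
  ring.
Qed.

Lemma smooth_frame_coords j :
  smooth_on I (fun t => coord2 (frame_coords j t)) /\ smooth_on I (fun t => coord3 (frame_coords j t)).
Proof.
  assert (VY := vsmooth_viter I s HI Hs Hs0 j Y HY).
  assert (V1 := gaf_smooth_E1 _ _ _ _ _ _ _ _ _ F). assert (V2 := gaf_smooth_E2 _ _ _ _ _ _ _ _ _ F).
  assert (V3 := gaf_smooth_E3 _ _ _ _ _ _ _ _ _ F).
  split.
  - apply (smooth_div I (fun t => det (E1 t) (viter s j Y t) (E3 t)) (fun t => det (E1 t) (E2 t) (E3 t)));
      auto; now apply (smooth_det I HI).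
  - apply (smooth_div I (fun t => det (E1 t) (E2 t) (viter s j Y t)) (fun t => det (E1 t) (E2 t) (E3 t)));
      auto; now apply (smooth_det I HI).
Qed.
End Field.

Definition ode1 (t : R) : R :=
  k3 t + 3 / 2 * k t * k2 t + 1 / 2 * (k1 t * k1 t) + 1 / 2 * (k t * k t) * k1 t
  - 1 / 5 * eps * k1 t + 6 / 5 * M1 t.

Definition ode2 (t : R) : R :=
  k2 t + 2 / 3 * k1 t * k t + 5 / 6 * eps * k1 t * M t - 3 / 2 * eps * k t * M1 t - eps * M2 t.

Lemma EL2_ode t : EL2 t = - (5 / 12) * eps * ode1 t.
Proof. unfold EL2, ode1. ring. Qed.

(** The terms of [EL3] of highest order in [k] are those of the derivative of [ode1]; after
    removing them and a multiple of [k ode1], the rest is proportional to [ode2]. *)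
Lemma EL3_ode t : I t ->
  EL3 t = eps / 6 * dpar s ode1 t + eps / 4 * k t * ode1 t - 3 / 10 * ode2 t.
Proof.
  intros Ht.
  assert (A1 := Dk t Ht). assert (A2 := Dk1 t Ht). assert (A3 := Dk2 t Ht). assert (A4 := Dk3 t Ht).
  assert (A5 := DM t Ht). assert (A6 := DM1 t Ht).
  assert (D : is_dpar s ode1 t (k4 t + 3 / 2 * (k1 t * k2 t + k t * k3 t) + k1 t * k2 t
     + k t * k1 t * k1 t + 1 / 2 * k t * k t * k2 t - 1 / 5 * eps * k2 t + 6 / 5 * M2 t)).
  { unfold ode1. dpar_by ltac:(field). }
  rewrite (dpar_unique I s Hs0 _ _ _ Ht D). unfold EL3, ode1, ode2.
  generalize (k t) (k1 t) (k2 t) (k3 t) (k4 t) (M t) (M1 t) (M2 t).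
  clear - Heps. intros.
  field_simplify_eq. replace (eps ^ 2) with 1 by lra. ring.
Qed.

(** On an open set [ode1 = 0] implies that its derivative vanishes, so the triangular
    relations [EL2_ode] and [EL3_ode] can be inverted. *)
Lemma EL_iff_ode :
  (forall t, I t -> EL2 t = 0 /\ EL3 t = 0) <-> (forall t, I t -> ode1 t = 0 /\ ode2 t = 0).
Proof.
  assert (He : eps <> 0) by (intros E; rewrite E in Heps; lra).
  assert (D : (forall t, I t -> ode1 t = 0) -> forall t, I t -> dpar s ode1 t = 0).
  { intros H t Ht. apply (dpar_unique I s Hs0); auto.
    apply (is_dpar_ext I s HI (fun _ => 0)); auto using is_dpar_const.
    intros u Hu; symmetry; auto. }
  split; intros H.
  - assert (H1 : forall t, I t -> ode1 t = 0).
    { intros t Ht. destruct (H t Ht) as [H2 _]. rewrite EL2_ode in H2.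
      apply Rmult_integral in H2. destruct H2; auto; lra. }
    intros t Ht. split; auto. destruct (H t Ht) as [_ H3].
    rewrite EL3_ode, D, H1 in H3 by auto. lra.
  - assert (H1 : forall t, I t -> ode1 t = 0) by (intros; now apply H).
    intros t Ht. rewrite EL2_ode, EL3_ode, D, H1 by auto.
    destruct (H t Ht) as [_ ->]. split; lra.
Qed.

Lemma smooth_EL : smooth_on I EL2 /\ smooth_on I EL3.
Proof.
  assert (HI' := HI). assert (S0 := Hk). assert (S1 := Hk1). assert (S2 := Hk2). assert (S3 := Hk3).
  assert (S4 := smooth_dpar I s HI Hs Hs0 _ Hk3 : smooth_on I k4).
  assert (T0 := HM). assert (T1 := HM1).
  assert (T2 := smooth_dpar I s HI Hs Hs0 _ HM1 : smooth_on I M2).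
  split; unfold EL2, EL3; smooth.
Qed.
End GeneralAffineFrame.

(** * Families of curves *)

Definition strip (I : R -> Prop) (delta : posreal) (eta t : R) : Prop := Rabs eta < delta /\ I t.

Definition vsmooth2_on (U : R -> R -> Prop) (X : R -> R -> V3) : Prop :=
  smooth2_on U (fun eta t => coord1 (X eta t)) /\
  smooth2_on U (fun eta t => coord2 (X eta t)) /\
  smooth2_on U (fun eta t => coord3 (X eta t)).

Definition var_field (X : R -> R -> V3) (eta t : R) : V3 :=
  vec (Derive (fun z => coord1 (X z t)) eta) (Derive (fun z => coord2 (X z t)) eta)
      (Derive (fun z => coord3 (X z t)) eta).

(** The length element of the curve [y], by [length_coef_curv]. The fourth root of
    the square of the curvature is a smooth way of writing the square root of its
    absolute value. *)
Definition length_density (s : R -> R) (y : R -> V3) (t : R) : R :=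
  Derive s t * Rpower (curve_curv s y t * curve_curv s y t) (1 / 4).

Lemma smooth_incl (I J : R -> Prop) f : (forall t, J t -> I t) -> smooth_on I f -> smooth_on J f.
Proof. intros H Hf n t Ht. apply (Hf n t (H t Ht)). Qed.

Section Families.
Context (I : R -> Prop) (delta : posreal) (s : R -> R).
Context (HI : open I) (Hs : smooth_on I (Derive s)) (Hs0 : forall t, I t -> 0 < Derive s t).

Let U := strip I delta.

Lemma strip_open : open2 U.
Proof.
  intros eta t [He Ht]. destruct (HI t Ht) as [r Hr].
  assert (Hd : 0 < Rmin (delta - Rabs eta) r) by (apply Rmin_pos; [lra|apply cond_pos]).
  exists (mkposreal _ Hd); simpl. intros u v Hu Hv. split.
  - assert (H := Rmin_l (delta - Rabs eta) r).
    replace u with ((u - eta) + eta) by ring.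
    apply Rle_lt_trans with (1 := Rabs_triang _ _). lra.
  - apply Hr. apply Rlt_le_trans with (1 := Hv). apply Rmin_r.
Qed.
Let HU := strip_open.

Lemma strip_0 t : I t -> U 0 t.
Proof. intros Ht. split; auto. rewrite Rabs_R0. apply cond_pos. Qed.

Lemma smooth2_dpar f : smooth2_on U f -> smooth2_on U (fun z => dpar s (f z)).
Proof.
  intros Hf. apply (smooth2_div U (fun z t => Derive (f z) t) (fun _ t => Derive s t)); auto.
  - intros u v [_ Hv]. specialize (Hs0 v Hv); lra.
  - now apply smooth2_Derive2.
  - apply (smooth2_lift U I); auto. now intros u v [_ Hv].
Qed.

Lemma smooth2_diter j f : smooth2_on U f -> smooth2_on U (fun z => diter s j (f z)).
Proof.
  intros Hf. induction j as [|j IH]; [exact Hf|].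
  exact (smooth2_dpar (fun z => diter s j (f z)) IH).
Qed.

(** Differentiation along the family commutes with differentiation in [s], because [s]
    is the same parameter on all curves of the family. *)
Lemma is_derive_diter j f eta t : smooth2_on U f -> U eta t ->
  is_derive (fun z => diter s j (f z) t) eta
    (diter s j (fun v => Derive (fun z => f z v) eta) t).
Proof.
  intros Hf. revert t. induction j as [|j IH]; intros t Ht.
  - apply Derive_correct. now apply (smooth2_ex_derive1 U).
  - set (g := fun z => diter s j (f z)).
    assert (Sg : smooth2_on U g) by now apply smooth2_diter.
    replace (diter s (S j) (fun v => Derive (fun z => f z v) eta) t)
      with (Derive (fun z => Derive (g z) t) eta / Derive s t).
    + apply is_derive_ext with (fun z => / Derive s t * Derive (g z) t).
      { intros z. unfold g. cbn [diter]. unfold dpar, Rdiv. apply Rmult_comm. }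
      unfold Rdiv. rewrite Rmult_comm.
      apply is_derive_scal, Derive_correct.
      apply (smooth2_ex_derive1 U (fun z t => Derive (g z) t)); auto.
      now apply smooth2_Derive2.
    + cbn [diter]. unfold dpar. f_equal.
      transitivity (Derive (fun v => Derive (fun z => g z v) eta) t).
      * apply Schwarz.
        -- apply (locally_2d_on U); auto. intros u v Huv. repeat split.
           ++ now apply (smooth2_ex_derive1 U).
           ++ now apply (smooth2_ex_derive2 U g).
           ++ apply (smooth2_ex_derive1 U (fun z t => Derive (g z) t)); auto.
              now apply smooth2_Derive2.
           ++ apply (smooth2_ex_derive2 U (fun u v => Derive (fun z => g z v) u)); auto.
              now apply smooth2_Derive1.
        -- apply (smooth2_cont U (fun u v => Derive (fun z => Derive (g z) v) u)); auto.
           now apply (smooth2_Derive1 U (fun z t => Derive (g z) t)), smooth2_Derive2.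
        -- apply (smooth2_cont U (fun u v => Derive (fun z => Derive (fun t => g t z) u) v)); auto.
           now apply (smooth2_Derive2 U (fun u v => Derive (fun z => g z v) u)), smooth2_Derive1.
      * apply Derive_ext_loc. apply filter_imp with I; [|apply HI, Ht].
        intros v Hv. apply is_derive_unique, IH. split; [apply Ht|exact Hv].
Qed.

Lemma vsmooth2_viter j X : vsmooth2_on U X -> vsmooth2_on U (fun z => viter s j (X z)).
Proof.
  intros (H1 & H2 & H3). split; [|split].
  - exact (smooth2_diter j (fun z t => coord1 (X z t)) H1).
  - exact (smooth2_diter j (fun z t => coord2 (X z t)) H2).
  - exact (smooth2_diter j (fun z t => coord3 (X z t)) H3).
Qed.

Lemma is_vdpar_id_viter j X eta t : vsmooth2_on U X -> U eta t ->
  is_vdpar (fun z => z) (fun z => viter s j (X z) t) eta (viter s j (var_field X eta) t).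
Proof.
  intros (H1 & H2 & H3) Ht. unfold is_vdpar, is_dpar. rewrite Derive_id, !Rmult_1_l.
  split; [|split].
  - exact (is_derive_diter j (fun z t => coord1 (X z t)) eta t H1 Ht).
  - exact (is_derive_diter j (fun z t => coord2 (X z t)) eta t H2 Ht).
  - exact (is_derive_diter j (fun z t => coord3 (X z t)) eta t H3 Ht).
Qed.

Lemma smooth2_det X Y Z : vsmooth2_on U X -> vsmooth2_on U Y -> vsmooth2_on U Z ->
  smooth2_on U (fun z t => det (X z t) (Y z t) (Z z t)).
Proof.
  intros (? & ? & ?) (? & ? & ?) (? & ? & ?). assert (HU' := HU). unfold det. smooth.
Qed.

Context (X : R -> R -> V3) (HX : vsmooth2_on U X).

Lemma smooth2_curve_det : smooth2_on U (fun z => curve_det s (X z)).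
Proof.
  exact (smooth2_det _ _ _ (vsmooth2_viter 1 X HX) (vsmooth2_viter 2 X HX) (vsmooth2_viter 3 X HX)).
Qed.

Context (HP : forall eta t, U eta t -> curve_det s (X eta) t <> 0).

Lemma smooth2_curve_curv : smooth2_on U (fun z => curve_curv s (X z)).
Proof.
  assert (V := fun j => vsmooth2_viter j X HX).
  assert (Q := fun i j k => smooth2_div U _ _ HU HP (smooth2_det _ _ _ (V i) (V j) (V k)) smooth2_curve_det).
  assert (HU' := HU).
  unfold curve_curv, rel_curv.
  apply (smooth2_minus U
    (fun z t => 5 / 3 * (det (viter s 1 (X z) t) (viter s 3 (X z) t) (viter s 4 (X z) t) / curve_det s (X z) t)
      + 2 / 3 * (det (viter s 1 (X z) t) (viter s 2 (X z) t) (viter s 5 (X z) t) / curve_det s (X z) t))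
    (fun z t => 35 / 36 * ((det (viter s 1 (X z) t) (viter s 2 (X z) t) (viter s 4 (X z) t) / curve_det s (X z) t)
      * (det (viter s 1 (X z) t) (viter s 2 (X z) t) (viter s 4 (X z) t) / curve_det s (X z) t)))); auto.
  - apply smooth2_plus; auto; (apply smooth2_mult; [assumption|now apply smooth2_const|apply Q]).
  - apply smooth2_mult; [assumption|now apply smooth2_const|]. apply smooth2_mult; [assumption|apply Q|apply Q].
Qed.

Context (HG : forall eta t, U eta t -> curve_curv s (X eta) t <> 0).

Lemma smooth2_length_density : smooth2_on U (fun z => length_density s (X z)).
Proof.
  assert (HG' := smooth2_curve_curv).
  apply (smooth2_mult U (fun _ t => Derive s t)
    (fun z t => Rpower (curve_curv s (X z) t * curve_curv s (X z) t) (1 / 4))); auto.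
  - apply (smooth2_lift U I); auto. now intros u v [_ Hv].
  - apply (smooth2_Rpower U (1 / 4) (fun z t => curve_curv s (X z) t * curve_curv s (X z) t)); auto.
    + intros u v Huv. specialize (HG u v Huv). nra.
    + apply smooth2_mult; auto.
Qed.

Lemma is_derive_curve_curv eta t : U eta t ->
  is_derive (fun z => curve_curv s (X z) t) eta
    (let Y := var_field X eta in
     var_rel_curv (viter s 1 (X eta) t) (viter s 2 (X eta) t) (viter s 3 (X eta) t)
       (viter s 4 (X eta) t) (viter s 5 (X eta) t)
       (viter s 1 Y t) (viter s 2 Y t) (viter s 3 Y t) (viter s 4 Y t) (viter s 5 Y t)).
Proof.
  intros Ht. cbv zeta.
  assert (V := fun j => is_vdpar_id_viter j X eta t HX Ht).
  assert (H := is_dpar_rel_curv (fun z => z) _ _ _ _ _ eta _ _ _ _ _ (HP eta t Ht) (V 1%nat) (V 2%nat) (V 3%nat) (V 4%nat) (V 5%nat)).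
  unfold is_dpar in H. rewrite Derive_id, Rmult_1_l in H. exact H.
Qed.

(** Differentiation under the integral sign; it applies because the density is smooth in
    both variables. *)
Lemma is_derive_length u v : u <= v -> (forall t, u <= t <= v -> I t) ->
  is_derive (fun eta => RInt (length_density s (X eta)) u v) 0
    (RInt (fun t => Derive (fun eta => length_density s (X eta) t) 0) u v).
Proof.
  intros Huv Hin.
  assert (HS := smooth2_length_density).
  assert (Hloc : locally 0 (fun eta => Rabs eta < delta)).
  { exists delta. intros y Hy. replace y with (y - 0) by ring. exact Hy. }
  apply (is_derive_RInt_param (fun eta t => length_density s (X eta) t));
    rewrite ?Rmin_left, ?Rmax_right by exact Huv.
  - apply filter_imp with (2 := Hloc). intros eta He t Ht.
    apply (smooth2_ex_derive1 U (fun z => length_density s (X z))); auto. split; auto.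
  - intros t Ht.
    apply (smooth2_cont U (fun u v => Derive (fun z => length_density s (X z) v) u)).
    + now apply (smooth2_Derive1 U (fun z => length_density s (X z))).
    + apply strip_0; auto.
  - apply filter_imp with (2 := Hloc). intros eta He.
    apply @ex_RInt_continuous. rewrite Rmin_left, Rmax_right by exact Huv.
    intros t Ht. apply @ex_derive_continuous.
    apply (smooth2_ex_derive2 U (fun z => length_density s (X z))); auto. split; auto.
Qed.
End Families.

(** * The first variation formula *)

Lemma zero_of_nearby_zeros f t :
  continuity_pt f t -> (forall d : posreal, exists u, Rabs (u - t) < d /\ f u = 0) -> f t = 0.
Proof.
  intros Hc Hz. destruct (Req_dec (f t) 0) as [|Hn]; auto. exfalso.
  destruct (continuous_neq_0 f t Hc Hn) as [d Hd].
  destruct (Hz d) as (u & Hu & Hfu). apply (Hd (u - t) Hu). now replace (t + (u - t)) with u by ring.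
Qed.

Lemma diter_0 s j t : diter s j (fun _ => 0) t = 0.
Proof.
  revert t. induction j as [|j IH]; intros t; auto.
  cbn [diter]. unfold dpar. rewrite (Derive_ext _ (fun _ => 0)) by exact IH.
  rewrite Derive_const. unfold Rdiv. apply Rmult_0_l.
Qed.

Section FirstVariation.
Context (I : R -> Prop) (s k M : R -> R) (eps : R) (x E1 E2 E3 : R -> V3).
Context (F : general_affine_frame I s k M eps x E1 E2 E3).
Let HI := gaf_open _ _ _ _ _ _ _ _ _ F.
Let Hs := gaf_smooth_s _ _ _ _ _ _ _ _ _ F.
Let Hs0 := gaf_s_pos _ _ _ _ _ _ _ _ _ F.
Let Heps := gaf_eps _ _ _ _ _ _ _ _ _ F.

(** Outside of [[u, v]] the field and all its derivatives vanish, hence so does [boundary];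
    the end points are reached by continuity. *)
Lemma boundary_vanishes Y u v :
  vsmooth_on I Y -> I u -> I v -> u <= v ->
  (forall t, I t -> t < u \/ v < t -> Y t = vec 0 0 0) ->
  boundary s k M eps E1 E2 E3 Y u = 0 /\ boundary s k M eps E1 E2 E3 Y v = 0.
Proof.
  intros SY Hu Hv Huv HY.
  assert (H0 : forall t, I t -> t < u \/ v < t -> boundary s k M eps E1 E2 E3 Y t = 0).
  { intros t Ht Htuv.
    assert (HJ : forall j, viter s j Y t = vec 0 0 0).
    { intros j. transitivity (viter s j (fun _ => vec 0 0 0) t).
      - apply (viter_ext (fun t => I t /\ (t < u \/ v < t))).
        + apply open_and; auto. apply open_or; [apply open_lt|apply open_gt].
        + intros z [Hz Hz']. auto.
        + auto.
      - apply V3_eq; unfold viter, vec; cbn [coord1 coord2 coord3 fst snd]; apply diter_0. }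
    assert (HC : forall j, frame_coords s E1 E2 E3 Y j t = vec 0 0 0).
    { intros j. unfold frame_coords. rewrite HJ.
      apply V3_eq; unfold coords, vec, det; cbn [coord1 coord2 coord3 fst snd]; unfold Rdiv; ring. }
    unfold boundary. rewrite !HC. unfold vec; cbn [coord1 coord2 coord3 fst snd]. ring. }
  assert (HC : forall t, I t -> continuity_pt (boundary s k M eps E1 E2 E3 Y) t).
  { intros t Ht. apply continuity_pt_filterlim, @ex_derive_continuous.
    eexists. apply (is_dpar_boundary I s k M eps x E1 E2 E3 F Y SY t Ht). }
  split; apply zero_of_nearby_zeros; auto; intros d.
  - destruct (HI u Hu) as [r Hr].
    assert (Hm : 0 < Rmin d r) by (apply Rmin_pos; apply cond_pos).
    assert (H1 := Rmin_l d r). assert (H2 := Rmin_r d r).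
    exists (u - Rmin d r / 2). assert (Hab : Rabs (u - Rmin d r / 2 - u) = Rmin d r / 2).
    { replace (u - _ - u) with (- (Rmin d r / 2)) by ring. rewrite Rabs_Ropp. apply Rabs_pos_eq; lra. }
    split; [lra|]. apply H0; [|left; lra].
    apply Hr. change (Rabs (u - Rmin d r / 2 - u) < r). lra.
  - destruct (HI v Hv) as [r Hr].
    assert (Hm : 0 < Rmin d r) by (apply Rmin_pos; apply cond_pos).
    assert (H1 := Rmin_l d r). assert (H2 := Rmin_r d r).
    exists (v + Rmin d r / 2). assert (Hab : Rabs (v + Rmin d r / 2 - v) = Rmin d r / 2).
    { replace (v + _ - v) with (Rmin d r / 2) by ring. apply Rabs_pos_eq; lra. }
    split; [lra|]. apply H0; [|right; lra].
    apply Hr. change (Rabs (v + Rmin d r / 2 - v) < r). lra.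
Qed.

Context (delta : posreal) (X : R -> R -> V3).
Context (HX : vsmooth2_on (strip I delta) X) (HX0 : forall t, I t -> X 0 t = x t).
Context (HP : forall eta t, strip I delta eta t -> curve_det s (X eta) t <> 0).
Context (HG : forall eta t, strip I delta eta t -> curve_curv s (X eta) t <> 0).
Let Y := var_field X 0.

Lemma vsmooth_var_field : vsmooth_on I Y.
Proof.
  destruct HX as (H1 & H2 & H3).
  assert (Hi : forall t, I t -> strip I delta 0 t) by (intros; now apply strip_0).
  split; [|split]; apply (smooth_incl (strip I delta 0)); auto.
  - exact (smooth2_slice _ _ 0 (smooth2_Derive1 _ _ H1)).
  - exact (smooth2_slice _ _ 0 (smooth2_Derive1 _ _ H2)).
  - exact (smooth2_slice _ _ 0 (smooth2_Derive1 _ _ H3)).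
Qed.

Lemma Derive_length_density t : I t ->
  Derive (fun eta => length_density s (X eta) t) 0 =
    Derive s t * (eps / 2 *
      var_rel_curv (viter s 1 x t) (viter s 2 x t) (viter s 3 x t) (viter s 4 x t) (viter s 5 x t)
        (viter s 1 Y t) (viter s 2 Y t) (viter s 3 Y t) (viter s 4 Y t) (viter s 5 Y t)).
Proof.
  intros Ht. apply is_derive_unique.
  assert (H := is_derive_curve_curv I delta s HI Hs Hs0 X HX HP 0 t (strip_0 _ _ t Ht)).
  cbv zeta in H. fold Y in H.
  rewrite !(fun j => viter_ext I s HI j (X 0) x t HX0 Ht) in H.
  set (D := var_rel_curv _ _ _ _ _ _ _ _ _ _) in *.
  assert (HE : curve_curv s (X 0) t = eps).
  { unfold curve_curv. rewrite !(fun j => viter_ext I s HI j (X 0) x t HX0 Ht).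
    apply (base_curv I s k M eps x E1 E2 E3 F t Ht). }
  unfold length_density. apply is_derive_scal.
  replace (eps / 2 * D) with ((D * eps + eps * D) * (1 / 4 * Rpower 1 (1 / 4 - 1))).
  2:{ unfold Rpower. rewrite ln_1, Rmult_0_r, exp_0. field. }
  apply (is_derive_comp (fun y => Rpower y (1 / 4)) (fun eta => curve_curv s (X eta) t * curve_curv s (X eta) t)).
  - rewrite HE, Heps. apply is_derive_Reals, derivable_pt_lim_power. lra.
  - rewrite <- HE at 1 2.
    apply (is_derive_mult (fun eta => curve_curv s (X eta) t) (fun eta => curve_curv s (X eta) t)); auto.
    intros; apply Rmult_comm.
Qed.

(** By [is_dpar_boundary] the integrand differs from the variation of the density by the
    derivative of [boundary], which vanishes at both ends. *)
Lemma first_variation u v :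
  u <= v -> (forall t, u <= t <= v -> I t) ->
  (forall t, I t -> t < u \/ v < t -> Y t = vec 0 0 0) ->
  is_derive (fun eta => RInt (length_density s (X eta)) u v) 0
    (RInt (fun t => Derive s t *
       (EL2 s k M eps t * coord2 (frame_coords s E1 E2 E3 Y 0 t)
        + EL3 s k M eps t * coord3 (frame_coords s E1 E2 E3 Y 0 t))) u v).
Proof.
  intros Huv Hin HY.
  assert (H := is_derive_length I delta s HI Hs Hs0 X HX HP HG u v Huv Hin).
  set (h := fun t => Derive s t * (EL2 s k M eps t * _ + _)).
  set (g := fun t => Derive (fun eta => length_density s (X eta) t) 0) in H.
  replace (RInt h u v) with (RInt g u v); auto.
  assert (SY := vsmooth_var_field).
  assert (Sg : smooth_on I g).
  { apply (smooth_incl (strip I delta 0)); [intros; now apply strip_0|].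
    exact (smooth2_slice _ _ 0 (smooth2_Derive1 _ _ (smooth2_length_density I delta s HI Hs Hs0 X HX HP HG))). }
  assert (Sh : smooth_on I h).
  { assert (HI' := HI). assert (Hs' := Hs).
    destruct (smooth_EL I s k M eps x E1 E2 E3 F) as [L2 L3].
    destruct (smooth_frame_coords I s k M eps x E1 E2 E3 F Y SY 0) as [C2 C3].
    unfold h. smooth. }
  assert (Cg : forall t, Rmin u v <= t <= Rmax u v -> continuous g t).
  { rewrite Rmin_left, Rmax_right by exact Huv. intros t Ht.
    apply @ex_derive_continuous, (smooth_ex_derive I); auto. }
  assert (Ch : forall t, Rmin u v <= t <= Rmax u v -> continuous h t).
  { rewrite Rmin_left, Rmax_right by exact Huv. intros t Ht.
    apply @ex_derive_continuous, (smooth_ex_derive I); auto. }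
  set (B := boundary s k M eps E1 E2 E3 Y).
  assert (HB : is_RInt (fun t => minus (g t) (h t)) u v (minus (B v) (B u))).
  { apply (@is_RInt_derive R_CompleteNormedModule B (fun t => minus (g t) (h t)) u v).
    - rewrite Rmin_left, Rmax_right by exact Huv. intros t Ht.
      assert (D := is_dpar_boundary I s k M eps x E1 E2 E3 F Y SY t (Hin t Ht)).
      unfold is_dpar in D. fold B in D.
      replace (minus (g t) (h t)) with (g t - h t) by reflexivity.
      unfold g. rewrite Derive_length_density by auto. unfold h.
      rewrite <- Rmult_minus_distr_l. exact D.
    - intros t Ht. apply @continuous_minus; auto. }
  destruct (boundary_vanishes Y u v SY (Hin u ltac:(lra)) (Hin v ltac:(lra)) Huv HY) as [Bu Bv].
  fold B in Bu, Bv. rewrite Bu, Bv in HB.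
  assert (HB' := @is_RInt_unique R_CompleteNormedModule _ _ _ _ HB). clear HB; rename HB' into HB.
  rewrite (@RInt_minus R_CompleteNormedModule g h) in HB by (apply (@ex_RInt_continuous R_CompleteNormedModule); auto).
  change (RInt g u v - RInt h u v = 0 - 0) in HB. lra.
Qed.
End FirstVariation.

(** * Deformations of a curve without inflection points *)

Lemma sign_sqr y : y <> 0 -> sign y * sign y = 1.
Proof.
  intros Hy. destruct (Rlt_or_le 0 y); [rewrite sign_eq_1|rewrite sign_eq_m1]; lra.
Qed.

Lemma sign_mul_pos y : y <> 0 -> 0 < sign y * y.
Proof.
  intros Hy. destruct (Rlt_or_le 0 y); [rewrite sign_eq_1|rewrite sign_eq_m1]; lra.
Qed.

(** Rescaling [e_i] by the [i]-th power of [p = (eps l)^(-1/2)] turns an affine frame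
    into a frame that is invariant under homotheties, whose structure equations in
    the length parameter only contain [k], [M] and [eps]. *)
Lemma general_affine_frame_exists I x e1 e2 e3 w l m s k M eps :
  open I -> affine_frame I x e1 e2 e3 w l m ->
  (forall t, I t -> l t <> 0) -> (forall t, I t -> eps = sign (l t)) ->
  eps * eps = 1 ->
  (forall t, I t -> is_derive s t (length_coef w l t)) ->
  (forall t, I t -> Derive l t / l t = k t * length_coef w l t) ->
  (forall t, I t -> M t = m t / Rpower (eps * l t) (3 / 2)) ->
  exists E1 E2 E3, general_affine_frame I s k M eps x E1 E2 E3.
Proof.
  intros HI F Hl Heps Heps2 Hs Hk HM.
  pose (p := fun t => Rpower (eps * l t) (- (1 / 2))).
  assert (Hel : forall t, I t -> 0 < eps * l t).
  { intros t Ht. rewrite (Heps t Ht). now apply sign_mul_pos, Hl. }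
  assert (Hp : forall t, 0 < p t) by (intros; apply exp_pos).
  assert (Hp2 : forall t, I t -> p t * p t * (eps * l t) = 1).
  { intros t Ht. unfold p. rewrite <- Rpower_plus.
    rewrite <- (Rpower_1 (eps * l t)) at 2 by now apply Hel.
    rewrite <- Rpower_plus. replace (- (1 / 2) + - (1 / 2) + 1) with 0 by field.
    now apply Rpower_O, Hel. }
  assert (Hlp : forall t, I t -> l t * (p t * p t) = eps).
  { intros t Ht. transitivity (eps * eps * (l t * (p t * p t))); [rewrite Heps2; ring|].
    transitivity (eps * (p t * p t * (eps * l t))); [ring|]. rewrite Hp2 by auto; ring. }
  assert (Hw : forall t, I t -> 0 < w t) by apply (frame_w_pos _ _ _ _ _ _ _ _ F).
  assert (Ds : forall t, I t -> Derive s t = w t * Rpower (eps * l t) (1 / 2)).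
  { intros t Ht. rewrite (is_derive_unique _ _ _ (Hs t Ht)). unfold length_coef.
    rewrite <- (Heps t Ht), <- Rpower_sqrt by now apply Hel.
    replace (/ 2) with (1 / 2) by field. apply Rmult_comm. }
  assert (Hwp : forall t, I t -> w t / Derive s t = p t).
  { intros t Ht. rewrite Ds by auto.
    assert (0 < w t) by auto.
    assert (0 < Rpower (eps * l t) (1 / 2)) by apply exp_pos.
    unfold p. rewrite Rpower_Ropp. field. split; lra. }
  assert (Hs0 : forall t, I t -> 0 < Derive s t).
  { intros t Ht. rewrite Ds by auto. apply Rmult_lt_0_compat; auto. apply exp_pos. }
  assert (Sl := frame_smooth_l _ _ _ _ _ _ _ _ F).
  assert (Sw := frame_smooth_w _ _ _ _ _ _ _ _ F).
  assert (Sm := frame_smooth_m _ _ _ _ _ _ _ _ F).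
  assert (Sel : smooth_on I (fun t => eps * l t)) by smooth.
  assert (Sp : smooth_on I p) by now apply smooth_pow.
  assert (Ss : smooth_on I (Derive s)).
  { apply (smooth_ext I HI (fun t => w t * Rpower (eps * l t) (1 / 2))).
    - intros; symmetry; auto.
    - apply smooth_mult; auto. now apply smooth_pow. }
  assert (Sk : smooth_on I k).
  { apply (smooth_ext I HI (fun t => Derive l t / l t / Derive s t)).
    - intros t Ht. rewrite (is_derive_unique _ _ _ (Hs t Ht)) , Hk by auto.
      assert (H := Hs0 t Ht). rewrite (is_derive_unique _ _ _ (Hs t Ht)) in H.
      field. lra.
    - apply smooth_div; auto.
      + intros t Ht; specialize (Hs0 t Ht); lra.
      + apply smooth_div; auto. now apply smooth_Derive. }
  assert (SM : smooth_on I M).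
  { apply (smooth_ext I HI (fun t => m t / Rpower (eps * l t) (3 / 2))).
    - intros; symmetry; auto.
    - apply smooth_div; auto.
      + intros t Ht. apply Rgt_not_eq, exp_pos.
      + now apply smooth_pow. }
  assert (HMp : forall t, I t -> M t = m t * (p t * p t * p t)).
  { intros t Ht. rewrite HM by auto. unfold Rdiv. f_equal.
    rewrite <- Rpower_Ropp. unfold p. rewrite <- !Rpower_plus. f_equal. field. }
  assert (Dp : forall t, I t -> is_dpar s p t (- (1 / 2) * k t * p t)).
  { intros t Ht. unfold is_dpar.
    assert (H := Hk t Ht). rewrite <- (is_derive_unique _ _ _ (Hs t Ht)) in H.
    replace (Derive s t * (- (1 / 2) * k t * p t))
      with (eps * Derive l t * (- (1 / 2) * Rpower (eps * l t) (- (1 / 2) - 1))).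
    - apply (is_derive_comp (fun y => Rpower y (- (1 / 2))) (fun t => eps * l t)).
      + apply is_derive_Reals, derivable_pt_lim_power. auto.
      + apply is_derive_scal. now apply (smooth_is_derive I).
    - transitivity (- (1 / 2) * p t * (k t * Derive s t)); [|ring]. rewrite <- H.
      replace (Rpower (eps * l t) (- (1 / 2) - 1)) with (p t * / (eps * l t)).
      + field. split; auto. intros E. rewrite E in Heps2. lra.
      + unfold Rminus. rewrite Rpower_plus, (Rpower_Ropp _ 1), Rpower_1 by auto. reflexivity. }
  exists (fun t => scal (p t) (e1 t)), (fun t => scal (p t * p t) (e2 t)),
    (fun t => scal (p t * p t * p t) (e3 t)).
  assert (J := fun t Ht => frame_dpar I s Hs0 _ _ _ _ _ _ _ t F Ht).
  destruct (frame_smooth_e1 _ _ _ _ _ _ _ _ F) as (S11 & S12 & S13).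
  destruct (frame_smooth_e2 _ _ _ _ _ _ _ _ F) as (S21 & S22 & S23).
  destruct (frame_smooth_e3 _ _ _ _ _ _ _ _ F) as (S31 & S32 & S33).
  split; auto.
  - split; [|split].
    + change (smooth_on I (fun t => p t * coord1 (e1 t))). smooth.
    + change (smooth_on I (fun t => p t * coord2 (e1 t))). smooth.
    + change (smooth_on I (fun t => p t * coord3 (e1 t))). smooth.
  - split; [|split].
    + change (smooth_on I (fun t => p t * p t * coord1 (e2 t))). smooth.
    + change (smooth_on I (fun t => p t * p t * coord2 (e2 t))). smooth.
    + change (smooth_on I (fun t => p t * p t * coord3 (e2 t))). smooth.
  - split; [|split].
    + change (smooth_on I (fun t => p t * p t * p t * coord1 (e3 t))). smooth.
    + change (smooth_on I (fun t => p t * p t * p t * coord2 (e3 t))). smooth.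
    + change (smooth_on I (fun t => p t * p t * p t * coord3 (e3 t))). smooth.
  - intros t Ht.
    replace (det _ _ _) with (p t ^ 6 * det (e1 t) (e2 t) (e3 t)).
    + apply Rmult_integral_contrapositive; split.
      * apply pow_nonzero, Rgt_not_eq, Hp.
      * apply lin_indep_det, (frame_indep _ _ _ _ _ _ _ _ F t Ht).
    + unfold det; coord; ring.
  - intros t Ht. destruct (J t Ht) as (J1 & _). now rewrite Hwp in J1.
  - intros t Ht. destruct (J t Ht) as (_ & J1 & _). rewrite Hwp in J1 by auto.
    eapply is_vdpar_eq; [apply is_vdpar_scal; eauto|vec_field].
  - intros t Ht. destruct (J t Ht) as (_ & _ & J2 & _). rewrite Hwp in J2 by auto.
    assert (Dp2 : is_dpar s (fun z => p z * p z) t (- k t * (p t * p t)))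
      by (assert (D := Dp t Ht); dpar_by ltac:(field)).
    eapply is_vdpar_eq; [apply is_vdpar_scal; eauto|vec_field].
  - intros t Ht. destruct (J t Ht) as (_ & _ & _ & J3). rewrite Hwp in J3 by auto.
    assert (Dp3 : is_dpar s (fun z => p z * p z * p z) t (- (3 / 2) * k t * (p t * p t * p t)))
      by (assert (D := Dp t Ht); dpar_by ltac:(field)).
    eapply is_vdpar_eq; [apply is_vdpar_scal; eauto|].
    rewrite HMp by auto.
    apply V3_eq; coord; rewrite <- (Hlp t Ht); field.
Qed.

Section Deformations.
Context (I : R -> Prop) (s k M : R -> R) (eps : R) (x E1 E2 E3 : R -> V3).
Context (F : general_affine_frame I s k M eps x E1 E2 E3).
Let HI := gaf_open _ _ _ _ _ _ _ _ _ F.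
Let Hs := gaf_smooth_s _ _ _ _ _ _ _ _ _ F.
Let Hs0 := gaf_s_pos _ _ _ _ _ _ _ _ _ F.

(** Without inflection points the length element is [length_density], whatever the frames
    used to compute it; in particular it is smooth in the deformation parameter although
    the frames of the different curves are unrelated. *)
Lemma is_length_element_density y sigma :
  without_affine_inflection I y -> is_length_element I y sigma ->
  forall t, I t -> curve_det s y t <> 0 /\ curve_curv s y t <> 0 /\ sigma t = length_density s y t.
Proof.
  intros Hinf (e1 & e2 & e3 & w & l & m & A & Hsig) t Ht.
  assert (Hl : l t <> 0).
  { intros E. apply (Hinf t Ht). now exists e1, e2, e3, w, l, m. }
  assert (HW : 0 < w t / Derive s t).
  { apply Rdiv_lt_0_compat; auto. apply (frame_w_pos _ _ _ _ _ _ _ _ A t Ht). }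
  destruct (frame_curv I s HI Hs Hs0 _ _ _ _ _ _ _ _ A Ht) as [Hdet Hcurv].
  split; [|split].
  - rewrite Hdet. apply Rmult_integral_contrapositive; split.
    + apply pow_nonzero; lra.
    + apply (frame_det_ne0 I _ _ _ _ _ _ _ _ A Ht).
  - rewrite Hcurv. apply Rmult_integral_contrapositive; split; auto. nra.
  - rewrite Hsig by auto. now apply (length_coef_curv I s HI Hs Hs0 y e1 e2 e3 w l m).
Qed.

(** [curve_curv] is [l] times a positive factor in any frame, so its zeros are exactly the
    inflection points. *)
Lemma is_length_element_of_curv y :
  vsmooth_on I y -> (forall t, I t -> curve_det s y t <> 0) ->
  (forall t, I t -> curve_curv s y t <> 0) ->
  nondegenerate I y /\ without_affine_inflection I y /\ is_length_element I y (length_density s y).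
Proof.
  intros Sy HP HG.
  destruct (frame_exists I s HI Hs Hs0 y Sy HP) as (e1 & e2 & e3 & w & l & m & A).
  assert (Hl : forall e1 e2 e3 w l m, affine_frame I y e1 e2 e3 w l m -> forall t, I t -> l t <> 0).
  { intros f1 f2 f3 w' l' m' A' t Ht E.
    destruct (frame_curv I s HI Hs Hs0 _ _ _ _ _ _ _ _ A' Ht) as [_ Hc].
    apply (HG t Ht). rewrite Hc, E. ring. }
  split; [|split].
  - intros t Ht. apply lin_indep_det.
    (* taking the parameter t itself as s turns curve_det into det (x', x'', x''') *)
    assert (Hid : forall t, Derive (fun z => z) t = 1) by (intros; apply Derive_id).
    assert (V : forall j f u, diter (fun z => z) j f u = Derive_n f j u).
    { induction j as [|j IH]; intros f u; auto. cbn [diter Derive_n]. unfold dpar.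
      rewrite Hid, (Derive_ext _ _ _ (IH f)). field. }
    assert (V' : forall j, vDerive_n y j t = viter (fun z => z) j y t).
    { intros j. unfold viter, vec, vDerive_n. now rewrite !V. }
    rewrite !V'. change (curve_det (fun z => z) y t <> 0).
    assert (Sid : smooth_on I (Derive (fun z => z))) by apply smooth_Derive, smooth_id.
    destruct (frame_curv I (fun z => z) HI Sid (fun t _ => eq_ind_r (Rlt 0) Rlt_0_1 (Hid t))
        _ _ _ _ _ _ _ _ A Ht) as [Hd _].
    rewrite Hd, Hid. assert (Hw := frame_w_pos _ _ _ _ _ _ _ _ A t Ht).
    apply Rmult_integral_contrapositive; split.
    + apply pow_nonzero. lra.
    + apply (frame_det_ne0 I _ _ _ _ _ _ _ _ A Ht).
  - intros t Ht (f1 & f2 & f3 & w' & l' & m' & A' & E). now apply (Hl _ _ _ _ _ _ A' t Ht).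
  - exists e1, e2, e3, w, l, m. split; auto. intros t Ht.
    symmetry. apply (length_coef_curv I s HI Hs Hs0 y e1 e2 e3 w l m); auto.
    now apply (Hl _ _ _ _ _ _ A).
Qed.

Lemma length_variation X delta C u v sigma :
  compact_deformation I x X delta C ->
  u <= v -> (forall t, u <= t <= v -> I t) -> (forall t, C t -> u <= t <= v) ->
  (forall eta, Rabs eta < delta -> is_length_element I (X eta) (sigma eta)) ->
  is_derive (fun eta => RInt (sigma eta) u v) 0
    (RInt (fun t => Derive s t *
       (EL2 s k M eps t * coord2 (frame_coords s E1 E2 E3 (var_field X 0) 0 t)
        + EL3 s k M eps t * coord3 (frame_coords s E1 E2 E3 (var_field X 0) 0 t))) u v).
Proof.
  intros D Huv Hin HC Hsig.
  assert (HL : forall eta t, strip I delta eta t ->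
     curve_det s (X eta) t <> 0 /\ curve_curv s (X eta) t <> 0 /\ sigma eta t = length_density s (X eta) t).
  { intros eta t [He Ht]. apply is_length_element_density; auto.
    apply (deform_no_inflection _ _ _ _ _ D eta He). }
  assert (Hloc : locally 0 (fun eta => Rabs eta < delta)).
  { exists delta. intros y Hy. replace y with (y - 0) by ring. exact Hy. }
  apply is_derive_ext_loc with (fun eta => RInt (length_density s (X eta)) u v).
  - apply filter_imp with (2 := Hloc). intros eta He.
    apply RInt_ext. rewrite Rmin_left, Rmax_right by exact Huv. intros t Ht.
    symmetry. apply HL. split; auto. apply Hin; lra.
  - apply (first_variation I s k M eps x E1 E2 E3 F delta); auto.
    + exact (deform_smooth _ _ _ _ _ D).
    + exact (deform_0 _ _ _ _ _ D).
    + intros; now apply HL.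
    + intros; now apply HL.
    + intros t Ht Htuv.
      assert (HX : forall eta, Rabs eta < delta -> X eta t = x t).
      { intros eta He. apply (deform_support _ _ _ _ _ D); auto. intros Hc. specialize (HC t Hc). lra. }
      assert (Z : forall c : V3 -> R, Derive (fun z => c (X z t)) 0 = 0).
      { intros c. transitivity (Derive (fun _ => c (x t)) 0); [|apply Derive_const]. apply Derive_ext_loc.
        apply filter_imp with (2 := Hloc). intros eta He. now rewrite HX. }
      unfold var_field. now rewrite !Z.
Qed.

Lemma extremal_of_EL :
  (forall t, I t -> EL2 s k M eps t = 0 /\ EL3 s k M eps t = 0) -> general_affine_extremal I x.
Proof.
  intros H X delta C D u v Huv Hin HC sigma Hsig.
  assert (V := length_variation X delta C u v sigma D Huv Hin HC Hsig).
  match type of V with is_derive _ _ ?i => replace i with 0 in V; [exact V|] end.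
  symmetry. transitivity (RInt (fun _ => 0) u v).
  - apply RInt_ext. rewrite Rmin_left, Rmax_right by exact Huv. intros t Ht.
    destruct (H t ltac:(apply Hin; lra)) as [H2 H3]. rewrite H2, H3.
    change (Derive s t * (0 * coord2 (frame_coords s E1 E2 E3 (var_field X 0) 0 t)
      + 0 * coord3 (frame_coords s E1 E2 E3 (var_field X 0) 0 t)) = 0). ring.
  - rewrite RInt_const. apply Rmult_0_r.
Qed.
End Deformations.

(** ** Bump functions *)

(** [x^(-n) exp(-1/x)] extended by [0]; the exponent [n] makes the family closed
    under differentiation. *)
Definition flat (n : nat) (x : R) : R :=
  if Rlt_dec 0 x then (/ x) ^ n * exp (- / x) else 0.

Lemma flat_pos n x : 0 < x -> flat n x = (/ x) ^ n * exp (- / x).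
Proof. intros Hx. unfold flat. now destruct (Rlt_dec 0 x). Qed.

Lemma flat_neg n x : x <= 0 -> flat n x = 0.
Proof. intros Hx. unfold flat. destruct (Rlt_dec 0 x); auto. lra. Qed.

(** Since [exp y >= y^(n+1)/(n+1)!] for [y = 1/x], [flat n] is at most linear near [0].
    Applied to [flat (n+1) x = flat n x / x], this gives the derivative zero at [0]. *)
Lemma flat_le n x : 0 < x -> 0 <= flat n x <= INR (Factorial.fact (S n)) * x.
Proof.
  intros Hx. rewrite flat_pos by auto. set (y := / x).
  assert (Hy : 0 < y) by now apply Rinv_0_lt_compat.
  assert (Hyn : forall j, 0 < y ^ j) by (intros; now apply pow_lt).
  assert (Hf : 0 < INR (Factorial.fact (S n))) by apply INR_fact_lt_0.
  assert (He : y ^ S n / INR (Factorial.fact (S n)) <= exp y).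
  { apply Rle_trans with (2 := exp_ge_taylor y (S n) (Rlt_le _ _ Hy)).
    rewrite tech5. rewrite <- (Rplus_0_l (y ^ S n / _)) at 1. apply Rplus_le_compat_r.
    apply cond_pos_sum. intros j. apply Rlt_le, Rdiv_lt_0_compat; auto. apply INR_fact_lt_0. }
  assert (Hexp : 0 < exp (- y)) by apply exp_pos.
  assert (Hee : exp y * exp (- y) = 1) by (rewrite <- exp_plus; rewrite Rplus_opp_r; apply exp_0).
  split; [apply Rlt_le, Rmult_lt_0_compat; auto|].
  replace x with (/ y) by (unfold y; apply Rinv_inv).
  apply Rmult_le_reg_l with (exp y * y); [apply Rmult_lt_0_compat; auto; apply exp_pos|].
  replace (exp y * y * (y ^ n * exp (- y))) with (y ^ S n * (exp y * exp (- y))) by (simpl; ring).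
  rewrite Hee, Rmult_1_r.
  replace (exp y * y * (INR (Factorial.fact (S n)) * / y)) with (INR (Factorial.fact (S n)) * exp y) by (field; lra).
  apply Rmult_le_reg_l with (/ INR (Factorial.fact (S n))); [now apply Rinv_0_lt_compat|].
  rewrite <- Rmult_assoc, Rinv_l, Rmult_1_l by lra. unfold Rdiv in He. lra.
Qed.

Lemma is_derive_flat n x :
  is_derive (flat n) x (- INR n * flat (S n) x + 1 * flat (S (S n)) x).
Proof.
  destruct (Rtotal_order x 0) as [Hx|[->|Hx]].
  - rewrite !flat_neg by lra. replace (_ + _) with 0 by ring.
    apply is_derive_ext_loc with (fun _ => 0); [|apply @is_derive_const].
    apply filter_imp with (fun z => z < 0); [|now apply open_lt].
    intros z Hz. symmetry. apply flat_neg. lra.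
  - rewrite !flat_neg by lra. replace (_ + _) with 0 by ring.
    apply is_derive_Reals. intros e He.
    assert (Hf : 0 < INR (Factorial.fact (S (S n)))) by apply INR_fact_lt_0.
    assert (Hd : 0 < e / INR (Factorial.fact (S (S n)))) by now apply Rdiv_lt_0_compat.
    exists (mkposreal _ Hd). simpl. intros h Hh0 Hh.
    rewrite Rplus_0_l, (flat_neg n 0) by lra.
    destruct (Rlt_or_le 0 h) as [Hh1|Hh1].
    + replace ((flat n h - 0) / h - 0) with (flat (S n) h)
        by (rewrite !flat_pos by auto; simpl; field; lra).
      destruct (flat_le (S n) h Hh1) as [H1 H2].
      rewrite Rabs_pos_eq in Hh |- * by lra.
      apply Rle_lt_trans with (1 := H2).
      apply Rmult_lt_reg_r with (/ INR (Factorial.fact (S (S n)))); [now apply Rinv_0_lt_compat|].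
      replace (INR _ * h * / INR _) with h by (field; lra). exact Hh.
    + rewrite flat_neg by auto. replace ((0 - 0) / h - 0) with 0 by (field; auto).
      now rewrite Rabs_R0.
  - apply is_derive_ext_loc with (fun z => (/ z) ^ n * exp (- / z)).
    + apply filter_imp with (fun z => 0 < z); [|now apply open_gt].
      intros z Hz. symmetry. now apply flat_pos.
    + rewrite !flat_pos by auto. auto_derive; [repeat split; lra|].
      destruct n as [|n].
      * simpl. field. lra.
      * rewrite S_INR. simpl. rewrite <- ?S_INR. field. lra.
Qed.

Definition bump (u v t : R) : R := flat 0 (t - u) * flat 0 (v - t).

Lemma smooth_flat n : smooth_on (fun _ => True) (flat n).
Proof.
  apply (smooth_family nat _ flat S (fun n => S (S n)) (fun n => - INR n) (fun _ => 1)).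
  - apply open_true.
  - intros; apply is_derive_flat.
Qed.

Lemma smooth_bump I u v : open I -> smooth_on I (bump u v).
Proof.
  intros HI. unfold bump. assert (Sid := smooth_id I).
  apply (smooth_mult I HI (fun t => flat 0 (t - u)) (fun t => flat 0 (v - t))).
  - apply (smooth_comp I HI (fun _ => True) (flat 0) (fun t => t - u)); auto using smooth_flat.
    apply (smooth_minus I HI (fun t => t) (fun _ => u)); auto. now apply smooth_const.
  - apply (smooth_comp I HI (fun _ => True) (flat 0) (fun t => v - t)); auto using smooth_flat.
    apply (smooth_minus I HI (fun _ => v) (fun t => t)); auto. now apply smooth_const.
Qed.

Lemma bump_pos u v t : u < t < v -> 0 < bump u v t.
Proof.
  intros Ht. unfold bump. rewrite !flat_pos by lra. simpl.
  rewrite !Rmult_1_l. apply Rmult_lt_0_compat; apply exp_pos.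
Qed.

Lemma bump_out u v t : t <= u \/ v <= t -> bump u v t = 0.
Proof.
  unfold bump. intros [Ht|Ht].
  - rewrite (flat_neg 0 (t - u)) by lra. ring.
  - rewrite (flat_neg 0 (v - t)) by lra. ring.
Qed.

(** * Extremal curves satisfy the Euler-Lagrange equations *)

Lemma smooth2_eta U : open2 U -> smooth2_on U (fun eta _ => eta).
Proof.
  intros HU n. destruct n as [|n].
  - intros eta t _; split; trivial. apply continuity_2d_pt_id1.
  - apply diff_on_S; split; [|split; [|split; [|split]]].
    + intros; apply continuity_2d_pt_id1.
    + intros; apply ex_derive_id.
    + intros; apply ex_derive_const.
    + apply diff_on_ext with (fun _ _ => 1); auto.
      * intros; symmetry; apply Derive_id.
      * now apply diff_on_const.
    + apply diff_on_ext with (fun _ _ => 0); auto.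
      * intros; symmetry; apply Derive_const.
      * now apply diff_on_const.
Qed.

(** The quotient [H eta t / H 0 t] is uniformly close to [1] for [t] in the compact
    [[u, v]] and [eta] small. *)
Lemma nonvanishing_family I (delta : posreal) H u v :
  open I -> smooth2_on (strip I delta) H -> (forall t, u <= t <= v -> I t) ->
  (forall t, I t -> H 0 t <> 0) ->
  (forall eta t, strip I delta eta t -> t < u \/ v < t -> H eta t = H 0 t) ->
  exists delta' : posreal, delta' <= delta /\ forall eta t, strip I delta' eta t -> H eta t <> 0.
Proof.
  intros HI SH Hin H0 Hout.
  destruct (uniform_continuity_2d_1d' (fun eta t => H eta t * / H 0 t) u v 0) with (eps := mkposreal _ Rlt_0_1)
    as [d Hd].
  - intros t Ht. assert (It := Hin t Ht).
    apply continuity_2d_pt_mult.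
    + apply (smooth2_cont (strip I delta)); auto. now apply strip_0.
    + apply (continuity_1d_2d_pt_comp (fun t => / H 0 t) (fun _ t => t)).
      * apply continuity_pt_inv; auto.
        apply continuity_pt_filterlim, @ex_derive_continuous.
        apply (smooth2_ex_derive2 (strip I delta) H); auto. now apply strip_0.
      * apply continuity_2d_pt_id2.
  - assert (Hm : 0 < Rmin d delta) by (apply Rmin_pos; apply cond_pos).
    exists (mkposreal _ Hm). split; [apply Rmin_r|].
    intros eta t [He It]. simpl in He.
    assert (Hs : strip I delta eta t).
    { split; auto. apply Rlt_le_trans with (1 := He), Rmin_r. }
    destruct (Rlt_or_le t u) as [|Hu]; [rewrite Hout; auto|].
    destruct (Rlt_or_le v t) as [|Hv]; [rewrite Hout; auto|].
    intros E.
    assert (Hed : Rabs eta < d) by apply (Rlt_le_trans _ _ _ He (Rmin_l _ _)).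
    assert (Hd0 := cond_pos d).
    specialize (Hd t 0 t eta). rewrite E, Rmult_0_l, Rinv_r in Hd by auto.
    destruct (Rabs_def2 _ _ Hed).
    assert (K : Rabs (0 - 1) < 1).
    { apply Hd; try lra. replace (t - t) with 0 by ring. now rewrite Rabs_R0. }
    replace (0 - 1) with (-(1)) in K by ring. rewrite Rabs_Ropp, Rabs_R1 in K. lra.
Qed.

Section Converse.
Context (I : R -> Prop) (s k M : R -> R) (eps : R) (x E1 E2 E3 : R -> V3).
Context (F : general_affine_frame I s k M eps x E1 E2 E3) (Sx : vsmooth_on I x).
Let HI := gaf_open _ _ _ _ _ _ _ _ _ F.
Let Hs := gaf_smooth_s _ _ _ _ _ _ _ _ _ F.
Let Hs0 := gaf_s_pos _ _ _ _ _ _ _ _ _ F.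
Let Heps := gaf_eps _ _ _ _ _ _ _ _ _ F.
Let HE := gaf_indep _ _ _ _ _ _ _ _ _ F.

Definition displaced (Y : R -> V3) (eta t : R) : V3 :=
  vec (coord1 (x t) + eta * coord1 (Y t)) (coord2 (x t) + eta * coord2 (Y t))
      (coord3 (x t) + eta * coord3 (Y t)).

Lemma var_field_displaced Y eta t : var_field (displaced Y) eta t = Y t.
Proof.
  assert (H : forall a b, Derive (fun z => a + z * b) eta = b).
  { intros a b. apply is_derive_unique. auto_derive; auto. ring. }
  apply V3_eq; unfold var_field, displaced, vec; cbn [coord1 coord2 coord3 fst snd]; apply H.
Qed.

(** A smooth field supported in [[u, v]] is the velocity of a deformation, because the
    inflection points and the degeneracies are excluded by open conditions on the
    compact [[u, v]] and do not move outside of it. *)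
Lemma displaced_deformation Y u v :
  vsmooth_on I Y -> (forall t, u <= t <= v -> I t) ->
  (forall t, I t -> t < u \/ v < t -> Y t = vec 0 0 0) ->
  exists delta : posreal,
    compact_deformation I x (displaced Y) delta (fun t => u <= t <= v) /\
    forall eta, Rabs eta < delta -> is_length_element I (displaced Y eta) (length_density s (displaced Y eta)).
Proof.
  intros SY Hin HY.
  assert (D0 : forall t, displaced Y 0 t = x t).
  { intros t. apply V3_eq; unfold displaced, vec; cbn [coord1 coord2 coord3 fst snd]; ring. }
  assert (Dout : forall eta t, I t -> t < u \/ v < t -> displaced Y eta t = x t).
  { intros eta t Ht Htuv. unfold displaced. rewrite HY by auto.
    apply V3_eq; unfold vec; cbn [coord1 coord2 coord3 fst snd]; ring. }
  assert (SX : forall delta, vsmooth2_on (strip I delta) (displaced Y)).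
  { intros delta. assert (HU := strip_open I delta HI).
    assert (Heta := smooth2_eta _ HU).
    assert (L : forall f, smooth_on I f -> smooth2_on (strip I delta) (fun _ t => f t)).
    { intros f Sf. apply (smooth2_lift _ I); auto. now intros eta t [_ Ht]. }
    destruct Sx as (X1 & X2 & X3), SY as (Y1 & Y2 & Y3).
    split; [|split];
      [apply (smooth2_plus (strip I delta) (fun _ t => coord1 (x t)) (fun eta t => eta * coord1 (Y t)))
      |apply (smooth2_plus (strip I delta) (fun _ t => coord2 (x t)) (fun eta t => eta * coord2 (Y t)))
      |apply (smooth2_plus (strip I delta) (fun _ t => coord3 (x t)) (fun eta t => eta * coord3 (Y t)))];
      auto;
      [apply (smooth2_mult (strip I delta) (fun eta _ => eta) (fun _ t => coord1 (Y t)))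
      |apply (smooth2_mult (strip I delta) (fun eta _ => eta) (fun _ t => coord2 (Y t)))
      |apply (smooth2_mult (strip I delta) (fun eta _ => eta) (fun _ t => coord3 (Y t)))]; auto. }
  assert (V0 : forall j t, I t -> viter s j (displaced Y 0) t = viter s j x t).
  { intros j t Ht. now apply (viter_ext I s HI). }
  assert (Vout : forall j eta t, I t -> t < u \/ v < t -> viter s j (displaced Y eta) t = viter s j x t).
  { intros j eta t Ht Htuv. apply (viter_ext (fun t => I t /\ (t < u \/ v < t))); auto.
    - apply open_and; auto. apply open_or; [apply open_lt|apply open_gt].
    - intros z [Hz Hz']. auto. }
  destruct (nonvanishing_family I (mkposreal 1 Rlt_0_1) (fun eta => curve_det s (displaced Y eta)) u v)
    as (d1 & Hd1 & HP); auto.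
  { apply (smooth2_curve_det I _ s HI Hs Hs0 (displaced Y)); auto. }
  { intros t Ht. unfold curve_det. rewrite !V0 by auto.
    destruct (base_curv I s k M eps x E1 E2 E3 F t Ht) as [B _]. unfold curve_det in B. rewrite B. auto. }
  { intros eta t [He Ht] Htuv. unfold curve_det. now rewrite !V0, !Vout by auto. }
  destruct (nonvanishing_family I d1 (fun eta => curve_curv s (displaced Y eta)) u v)
    as (d2 & Hd2 & HG); auto.
  { apply (smooth2_curve_curv I d1 s HI Hs Hs0 (displaced Y)); auto. }
  { intros t Ht. unfold curve_curv. rewrite !V0 by auto.
    destruct (base_curv I s k M eps x E1 E2 E3 F t Ht) as [_ B]. unfold curve_curv in B. rewrite B.
    intros E. rewrite E in Heps. lra. }
  { intros eta t [He Ht] Htuv. unfold curve_curv. now rewrite !V0, !Vout by auto. }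
  assert (HL : forall eta, Rabs eta < d2 ->
    nondegenerate I (displaced Y eta) /\ without_affine_inflection I (displaced Y eta) /\
    is_length_element I (displaced Y eta) (length_density s (displaced Y eta))).
  { intros eta He. apply (is_length_element_of_curv I s k M eps x E1 E2 E3 F).
    - destruct (SX d2) as (X1 & X2 & X3).
      assert (Hi : forall t, I t -> strip I d2 eta t) by (intros; split; auto).
      split; [|split]; apply (smooth_incl (strip I d2 eta)); auto.
      + exact (smooth2_slice _ _ eta X1).
      + exact (smooth2_slice _ _ eta X2).
      + exact (smooth2_slice _ _ eta X3).
    - intros t Ht. apply HP. split; auto. lra.
    - intros t Ht. apply HG. split; auto. }
  exists d2. split; [|intros; now apply HL].
  split.
  - exact (SX d2).
  - intros; now apply HL.
  - intros; now apply HL.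
  - auto.
  - apply compact_P3.
  - auto.
  - intros eta t He Ht Hn. apply Dout; auto.
    destruct (Rlt_or_le t u); auto. destruct (Rlt_or_le v t); auto. exfalso; apply Hn; lra.
Qed.

(** Otherwise [EL2^2 + EL3^2] is positive on an interval, and moving [x] there along
    [EL2 E2 + EL3 E3], cut off by a bump function, increases the length to first order. *)
Lemma EL_of_extremal :
  general_affine_extremal I x -> forall t, I t -> EL2 s k M eps t = 0 /\ EL3 s k M eps t = 0.
Proof.
  intros Hext t0 Ht0.
  set (L2 := EL2 s k M eps). set (L3 := EL3 s k M eps).
  destruct (smooth_EL I s k M eps x E1 E2 E3 F) as [S2 S3]. fold L2 in S2. fold L3 in S3.
  pose (N := fun t => L2 t * L2 t + L3 t * L3 t).
  assert (HI' := HI).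
  assert (SN : smooth_on I N) by (unfold N; smooth).
  enough (HN : N t0 = 0) by (unfold N in HN; split; nra).
  destruct (Req_dec (N t0) 0) as [|Hne]; auto. exfalso.
  (* an interval on which N does not vanish *)
  destruct (HI t0 Ht0) as [r1 Hr1].
  destruct (continuous_neq_0 N t0 (smooth_cont I N t0 SN Ht0) Hne) as [r2 Hr2].
  set (r := Rmin r1 r2 / 2).
  assert (Hr : 0 < r /\ r < r1 /\ r < r2).
  { assert (0 < Rmin r1 r2) by (apply Rmin_pos; apply cond_pos).
    assert (H1 := Rmin_l r1 r2). assert (H2 := Rmin_r r1 r2). unfold r. lra. }
  set (u := t0 - r). set (v := t0 + r).
  assert (Hball : forall t, u <= t <= v -> Rabs (t - t0) <= r).
  { intros t Ht. unfold u, v in Ht. apply Rabs_le. lra. }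
  assert (Hin : forall t, u <= t <= v -> I t).
  { intros t Ht. apply Hr1. change (Rabs (t - t0) < r1). specialize (Hball t Ht). lra. }
  assert (HNpos : forall t, u <= t <= v -> 0 < N t).
  { intros t Ht. assert (Hn : N t <> 0).
    { replace t with (t0 + (t - t0)) by ring. apply Hr2. specialize (Hball t Ht). lra. }
    assert (0 <= N t) by (unfold N; nra). lra. }
  pose (Y := fun t => lin_comb (E1 t) (E2 t) (E3 t) (vec 0 (bump u v t * L2 t) (bump u v t * L3 t))).
  assert (SY : vsmooth_on I Y).
  { assert (Sb := smooth_bump I u v HI).
    destruct (gaf_smooth_E2 _ _ _ _ _ _ _ _ _ F) as (A1 & A2 & A3).
    destruct (gaf_smooth_E3 _ _ _ _ _ _ _ _ _ F) as (B1 & B2 & B3).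
    destruct (gaf_smooth_E1 _ _ _ _ _ _ _ _ _ F) as (C1 & C2 & C3).
    split; [|split]; unfold Y, lin_comb, vec; cbn [coord1 coord2 coord3 fst snd]; smooth. }
  assert (HY : forall t, I t -> t < u \/ v < t -> Y t = vec 0 0 0).
  { intros t Ht Htuv. unfold Y. rewrite bump_out by lra.
    apply V3_eq; unfold lin_comb, vec; cbn [coord1 coord2 coord3 fst snd]; ring. }
  destruct (displaced_deformation Y u v SY Hin HY) as (delta & D & Hlen).
  assert (Huv : u <= v) by (unfold u, v; lra).
  assert (Z := Hext _ _ _ D u v Huv Hin (fun t Ht => Ht) _ Hlen).
  assert (V := length_variation I s k M eps x E1 E2 E3 F _ _ _ u v _ D Huv Hin (fun t Ht => Ht) Hlen).
  assert (E := eq_trans (eq_sym (is_derive_unique _ _ _ V)) (is_derive_unique _ _ _ Z)).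
  assert (P : 0 < RInt (fun t => Derive s t * (bump u v t * N t)) u v).
  { apply RInt_gt_0.
    - unfold u, v; lra.
    - intros t Ht. apply Rmult_lt_0_compat; [apply Hs0, Hin; lra|].
      apply Rmult_lt_0_compat; [now apply bump_pos|apply HNpos; lra].
    - intros t Ht. apply @ex_derive_continuous, (smooth_ex_derive I); [|now apply Hin].
      assert (Sb := smooth_bump I u v HI). assert (Hs' := Hs). smooth. }
  rewrite (RInt_ext _ (fun t => Derive s t * (bump u v t * N t))) in E; [lra|].
  rewrite Rmin_left, Rmax_right by exact Huv. intros t Ht.
  assert (It : I t) by (apply Hin; lra).
  assert (HC : frame_coords s E1 E2 E3 (var_field (displaced Y) 0) 0 t
     = vec 0 (bump u v t * L2 t) (bump u v t * L3 t)).
  { unfold frame_coords.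
    replace (viter s 0 _ t) with (Y t)
      by (rewrite <- (var_field_displaced Y 0 t); now apply V3_eq).
    assert (Hd := HE t It). unfold coords, Y.
    destruct (det_lin_comb1 (E1 t) (E2 t) (E3 t) (vec 0 (bump u v t * L2 t) (bump u v t * L3 t)))
      as (-> & -> & ->).
    apply V3_eq; unfold vec; cbn [coord1 coord2 coord3 fst snd]; now field. }
  rewrite HC. unfold vec, N; cbn [coord1 coord2 coord3 fst snd]. fold L2 L3. cbv beta.
  match goal with |- ?a = ?b => change (a = b :> R) end. ring.
Qed.
End Converse.

(** * The differential equations of extremal curves *)

Theorem theorem6p1 (a b : Rbar) (x e1 e2 e3 : R -> V3) (w l m s k M : R -> R) (eps : R)
  (Hab : Rbar_lt a b)
  (Hx : vsmooth_on (interval a b) x)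
  (Hnondeg : nondegenerate (interval a b) x)
  (Hinfl : without_affine_inflection (interval a b) x)
  (Hframe : affine_frame (interval a b) x e1 e2 e3 w l m)
  (Heps : forall t : R, interval a b t -> eps = sign (l t))
  (Hs : forall t : R, interval a b t -> is_derive s t (length_coef w l t))
  (Hk : forall t : R, interval a b t -> Derive l t / l t = k t * length_coef w l t)
  (HM : forall t : R, interval a b t -> M t = m t / Rpower (eps * l t) (3 / 2)) :
  (general_affine_extremal (interval a b) x <->
   forall t : R, interval a b t ->
     let k1 := dpar s k in let k2 := dpar s k1 in let k3 := dpar s k2 in
     let M1 := dpar s M in let M2 := dpar s M1 in
     k3 t + 3 / 2 * k t * k2 t + 1 / 2 * (k1 t) ^ 2 + 1 / 2 * (k t) ^ 2 * k1 t
       - 1 / 5 * eps * k1 t + 6 / 5 * M1 t = 0 /\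
     k2 t + 2 / 3 * k1 t * k t + 5 / 6 * eps * k1 t * M t
       - 3 / 2 * eps * k t * M1 t - eps * M2 t = 0) /\
  ((exists k0 : R, forall t : R, interval a b t -> k t = k0) ->
   (exists M0 : R, forall t : R, interval a b t -> M t = M0) ->
   general_affine_extremal (interval a b) x).
Proof.
  set (I := interval a b) in *.
  assert (HI : open I) by apply interval_open.
  assert (Hl : forall t, I t -> l t <> 0).
  { intros t Ht E. apply (Hinfl t Ht). now exists e1, e2, e3, w, l, m. }
  assert (Heps2 : eps * eps = 1).
  { destruct (interval_nonempty a b Hab) as [t Ht].
    rewrite (Heps t Ht). now apply sign_sqr, Hl. }
  destruct (general_affine_frame_exists I x e1 e2 e3 w l m s k M eps HI Hframe Hl Heps Heps2 Hs Hk HM)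
    as (E1 & E2 & E3 & F).
  assert (Hode : general_affine_extremal I x <-> forall t, I t -> ode1 s k M eps t = 0 /\ ode2 s k M eps t = 0).
  { rewrite <- (EL_iff_ode I s k M eps x E1 E2 E3 F). split.
    - now apply (EL_of_extremal I s k M eps x E1 E2 E3 F).
    - now apply (extremal_of_EL I s k M eps x E1 E2 E3 F). }
  split.
  - rewrite Hode. unfold ode1, ode2. cbv zeta.
    split; intros H t Ht; specialize (H t Ht); cbn [pow] in *; rewrite !Rmult_1_r in *; exact H.
  - intros [k0 Hk0] [M0 HM0]. apply Hode.
    assert (C : forall f c, (forall t, I t -> f t = c) -> forall t, I t -> dpar s f t = 0).
    { intros f c Hf t Ht. rewrite (dpar_ext I s HI f (fun _ => c)) by auto.
      unfold dpar. rewrite Derive_const. apply Rmult_0_l. }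
    assert (K1 := C _ _ Hk0). assert (K2 := C _ _ K1). assert (K3 := C _ _ K2).
    assert (M1 := C _ _ HM0). assert (M2 := C _ _ M1).
    intros t Ht. unfold ode1, ode2. rewrite K1, K2, K3, M1, M2 by auto. split; ring.
Qed.
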